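(* Every equation of the class $[A_{3,3}\oplus A_1]$ of Euler-Bernoulli equations can be mapped, by an invertible change of the independent and dependent variables, to the uniform equation $$U_{XXXX}+U_{TT}=0.$$ Moreover, a transformation that maps an arbitrary element $(f(x)u_{xx})_{xx}+g'(x)^4f(x)u_{tt}=0$ of $[A_{3,3}\oplus A_1]$ to this equation is given by $$T=t+k_1,\qquad X=g(x)+k_2,\qquad U=k_3\,u\,\sqrt{f(x)\,g'(x)^3},$$ where $k_1$, $k_2$ and $k_3\neq0$ are arbitrary constants.
   Context: An Euler-Bernoulli equation is an equation $\frac{\partial^2}{\partial x^2}\left(f(x)\frac{\partial^2u}{\partial x^2}\right)+m(x)\frac{\partial^2u}{\partial t^2}=0$ for $u(t,x)$, with $x$ in an interval, and with $f>0$, $m>0$ smooth. One writes $m=(g')^4f$ with $g'>0$; $g$ is determined up to an additive constant. Its Lie algebra of Lie point symmetries (vector fields $\tau(t,x,u)\partial_t+\xi(t,x,u)\partial_x+\eta(t,x,u)\partial_u$ whose fourth prolongation annihilates the equation on its solution set in jet space) has the form $L^r\oplus L^\infty$, where $L^\infty$ is the ideal of solution symmetries $a(t,x)\partial_u$, $a$ being a solution of the equation, and $L^r$ is the finite-dimensional part. The class $[A_{3,3}\oplus A_1]$ is the set of Euler-Bernoulli equations for which the finite part is the four-dimensional Lie algebra spanned by $$X_1=\partial_t,\quad X_2=u\partial_u,\quad X_3=4t\,\partial_t+\frac{2g}{g'}\partial_x-\left(\frac{f'g}{fg'}+\frac{3gg''}{g'^2}\right)u\,\partial_u,\quad X_4=\frac{2}{g'}\partial_x-\left(\frac{f'}{fg'}+\frac{3g''}{g'^2}\right)u\,\partial_u,$$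 with nonzero brackets $[X_1,X_3]=4X_1$, $[X_3,X_4]=-2X_4$. Equivalently, it is the set of those equations for which $$g^{(3)}=\frac{3}{10}\frac{g'f'^2}{f^2}-\frac25\frac{g'f''}{f}+\frac32\frac{g''^2}{g'},\qquad f^{(4)}=\frac{f'f^{(3)}}{f}+\frac{11}{10}\frac{f''^2}{f}-\frac{12}{5}\frac{f'^2f''}{f^2}+\frac{9}{10}\frac{f'^4}{f^3}.$$ *)

(* Defs.v *)
(* Stdlib reals with Coquelicot. *)
From Stdlib Require Import Reals.
From Coquelicot Require Import Coquelicot.
Open Scope R_scope.

Definition itv (a b : Rbar) (x : R) : Prop := Rbar_lt a x /\ Rbar_lt x b.

(* In all that follows J is an open interval (the range of x).  Functions of x
   are total, but only their values on J matter. *)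

Definition smooth (J : R -> Prop) (h : R -> R) : Prop :=
  forall (n : nat) (x : R), J x -> ex_derive_n h n x.

Fixpoint C2 (k : nat) (D : R * R -> Prop) (u : R * R -> R) : Prop :=
  (forall p, D p -> continuous u p) /\
  match k with
  | O => True
  | S k' =>
      (forall t x, D (t, x) -> ex_derive (fun s => u (s, x)) t) /\
      (forall t x, D (t, x) -> ex_derive (fun y => u (t, y)) x) /\
      C2 k' D (fun '(t, x) => Derive (fun s => u (s, x)) t) /\
      C2 k' D (fun '(t, x) => Derive (fun y => u (t, y)) x)
  end.

Fixpoint C3 (k : nat) (D : R * R * R -> Prop) (F : R * R * R -> R) : Prop :=
  (forall p, D p -> continuous F p) /\
  match k with
  | O => True
  | S k' =>
      (forall t x u, D (t, x, u) -> ex_derive (fun s => F (s, x, u)) t) /\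
      (forall t x u, D (t, x, u) -> ex_derive (fun y => F (t, y, u)) x) /\
      (forall t x u, D (t, x, u) -> ex_derive (fun w => F (t, x, w)) u) /\
      C3 k' D (fun '(t, x, u) => Derive (fun s => F (s, x, u)) t) /\
      C3 k' D (fun '(t, x, u) => Derive (fun y => F (t, y, u)) x) /\
      C3 k' D (fun '(t, x, u) => Derive (fun w => F (t, x, w)) u)
  end.

Definition smooth3 (D : R * R * R -> Prop) (F : R * R * R -> R) : Prop :=
  forall k : nat, C3 k D F.

Definition strip (J : R -> Prop) : R * R -> Prop := fun '(t, x) => J x.
Definition cylinder (J : R -> Prop) : R * R * R -> Prop := fun '(t, x, u) => J x.

(* Classical (C^4) solutions of (f u_xx)_xx + m u_tt = 0 on the plane domain Om. *)
Definition eb_solution (f m : R -> R) (Om : R * R -> Prop) (u : R * R -> R) : Prop :=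
  C2 4 Om u /\
  forall t x, Om (t, x) ->
    Derive_n (fun y => f y * Derive_n (fun z => u (t, z)) 2 y) 2 x
    + m x * Derive_n (fun s => u (s, x)) 2 t = 0.

Definition uniform_solution (Om : R * R -> Prop) (U : R * R -> R) : Prop :=
  C2 4 Om U /\
  forall T X, Om (T, X) ->
    Derive_n (fun Y => U (T, Y)) 4 X + Derive_n (fun s => U (s, X)) 2 T = 0.

(* Jet coordinates: [cu i j] stands for the derivative of u taken i times in t
   and j times in x; [cu 0 0] is u itself.  A function on the jet space of order
   n is a function of [jet] depending only on t, x and the [cu i j], i + j <= n. *)
Inductive coord : Set := ct | cx | cu (i j : nat).

Definition coord_eq_dec : forall c d : coord, {c = d} + {c <> d}.
Proof. decide equality; apply Nat.eq_dec. Defined.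

Definition jet : Type := coord -> R.

Definition upd (p : jet) (c : coord) (s : R) : jet :=
  fun d => if coord_eq_dec c d then s else p d.

Definition pd (c : coord) (F : jet -> R) : jet -> R :=
  fun p => Derive (fun s => F (upd p c s)) (p c).

Definition sum_order (n : nat) (G : nat -> nat -> R) : R :=
  sum_f_R0 (fun i => sum_f_R0 (fun j => G i j) (n - i)) n.

(* Total derivatives of a function on the jet space of order n. *)
Definition totDt (n : nat) (F : jet -> R) : jet -> R :=
  fun p => pd ct F p + sum_order n (fun i j => p (cu (S i) j) * pd (cu i j) F p).
Definition totDx (n : nat) (F : jet -> R) : jet -> R :=
  fun p => pd cx F p + sum_order n (fun i j => p (cu i (S j)) * pd (cu i j) F p).

(* The left-hand side of the equation as a function on the jet space of order 4. *)
Definition eb_jet (f m : R -> R) : jet -> R :=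
  fun p => totDx 3 (totDx 2 (fun q => f (q cx) * q (cu 0 2))) p + m (p cx) * p (cu 2 0).

(* vt d/dt + vx d/dx + vu d/du on (t, x, u)-space. *)
Record vfield : Type := VField { vt : R * R * R -> R;
                                 vx : R * R * R -> R;
                                 vu : R * R * R -> R }.

Definition on_jet (F : R * R * R -> R) : jet -> R :=
  fun p => F (p ct, p cx, p (cu 0 0)).

(* Coefficient of d/du_{i,j} in the prolongation of v, by the usual recursion
   phi^{K,x} = D_x phi^K - u_{K,t} D_x tau - u_{K,x} D_x xi, and likewise for t. *)
Fixpoint prol_t (v : vfield) (i : nat) : jet -> R :=
  match i with
  | O => on_jet (vu v)
  | S i' => fun p =>
      totDt i' (prol_t v i') p
      - p (cu (S i') 0) * totDt 0 (on_jet (vt v)) p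
      - p (cu i' 1) * totDt 0 (on_jet (vx v)) p
  end.

Fixpoint prol_coef (v : vfield) (i j : nat) : jet -> R :=
  match j with
  | O => prol_t v i
  | S j' => fun p =>
      totDx (i + j') (prol_coef v i j') p
      - p (cu (S i) j') * totDx 0 (on_jet (vt v)) p
      - p (cu i (S j')) * totDx 0 (on_jet (vx v)) p
  end.

(* The n-th prolongation of v applied to a function on the jet space of order n. *)
Definition prolong (n : nat) (v : vfield) (F : jet -> R) : jet -> R :=
  fun p => on_jet (vt v) p * pd ct F p + on_jet (vx v) p * pd cx F p
           + sum_order n (fun i j => prol_coef v i j p * pd (cu i j) F p).

Definition smooth_vfield (J : R -> Prop) (v : vfield) : Prop :=
  smooth3 (cylinder J) (vt v) /\ smooth3 (cylinder J) (vx v) /\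
  smooth3 (cylinder J) (vu v).

Definition eb_symmetry (J : R -> Prop) (f m : R -> R) (v : vfield) : Prop :=
  smooth_vfield J v /\
  forall p : jet, J (p cx) -> eb_jet f m p = 0 -> prolong 4 v (eb_jet f m) p = 0.

Definition vadd (v w : vfield) : vfield :=
  VField (fun q => vt v q + vt w q) (fun q => vx v q + vx w q)
         (fun q => vu v q + vu w q).
Definition vscal (c : R) (v : vfield) : vfield :=
  VField (fun q => c * vt v q) (fun q => c * vx v q) (fun q => c * vu v q).
Definition veq (J : R -> Prop) (v w : vfield) : Prop :=
  forall q, cylinder J q -> vt v q = vt w q /\ vx v q = vx w q /\ vu v q = vu w q.

Definition solution_field (a : R * R -> R) : vfield :=
  VField (fun _ => 0) (fun _ => 0) (fun '(t, x, u) => a (t, x)).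

Definition X1 : vfield := VField (fun _ => 1) (fun _ => 0) (fun _ => 0).
Definition X2 : vfield := VField (fun _ => 0) (fun _ => 0) (fun '(t, x, u) => u).
Definition X3 (f g : R -> R) : vfield :=
  VField (fun '(t, x, u) => 4 * t)
         (fun '(t, x, u) => 2 * g x / Derive g x)
         (fun '(t, x, u) => - (Derive f x * g x / (f x * Derive g x)
                               + 3 * g x * Derive_n g 2 x / (Derive g x) ^ 2) * u).
Definition X4 (f g : R -> R) : vfield :=
  VField (fun _ => 0)
         (fun '(t, x, u) => 2 / Derive g x)
         (fun '(t, x, u) => - (Derive f x / (f x * Derive g x)
                               + 3 * Derive_n g 2 x / (Derive g x) ^ 2) * u).

Definition eb_coefficients (J : R -> Prop) (f m : R -> R) : Prop :=
  smooth J f /\ smooth J m /\ forall x, J x -> 0 < f x /\ 0 < m x.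

Definition eb_gauge (J : R -> Prop) (f m g : R -> R) : Prop :=
  smooth J g /\
  forall x, J x -> 0 < Derive g x /\ m x = (Derive g x) ^ 4 * f x.

(* The class [A_{3,3} + A_1]: the symmetry algebra is the sum of span(X1, .., X4)
   and the solution symmetries.  On a nonempty J with g' > 0 the four fields are
   automatically independent, and their span meets the solution symmetries in 0
   only.  Replacing g by g + c does not change the span, so it does not matter
   which g is chosen. *)
Definition class_A33_A1 (J : R -> Prop) (f m : R -> R) : Prop :=
  eb_coefficients J f m /\
  exists g : R -> R, eb_gauge J f m g /\
    forall v : vfield, smooth_vfield J v ->
      (eb_symmetry J f m v <->
       exists (c1 c2 c3 c4 : R) (a : R * R -> R),
         eb_solution f m (strip J) a /\
         veq J v (vadd (vadd (vadd (vadd (vscal c1 X1) (vscal c2 X2))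
                                   (vscal c3 (X3 f g))) (vscal c4 (X4 f g)))
                       (solution_field a))).

Definition image3 (D : R * R * R -> Prop) (Phi : R * R * R -> R * R * R)
  : R * R * R -> Prop := fun q => exists p, D p /\ Phi p = q.

Definition smooth_map3 (D : R * R * R -> Prop) (Phi : R * R * R -> R * R * R) : Prop :=
  smooth3 D (fun p => fst (fst (Phi p))) /\
  smooth3 D (fun p => snd (fst (Phi p))) /\
  smooth3 D (fun p => snd (Phi p)).

(* An invertible change of variables (t, x, u) -> (T, X, U): a smooth
   diffeomorphism of the domain D onto an open set. *)
Definition invertible_change (D : R * R * R -> Prop)
    (Phi : R * R * R -> R * R * R) : Prop :=
  smooth_map3 D Phi /\ open (image3 D Phi) /\
  exists Psi : R * R * R -> R * R * R,
    smooth_map3 (image3 D Phi) Psi /\ forall p, D p -> Psi (Phi p) = p.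

(* Phi carries the graph of u over Om onto the graph of U over Om'. *)
Definition transforms (Phi : R * R * R -> R * R * R)
    (Om : R * R -> Prop) (u : R * R -> R)
    (Om' : R * R -> Prop) (U : R * R -> R) : Prop :=
  forall q : R * R * R,
    (exists t x, Om (t, x) /\ Phi (t, x, u (t, x)) = q) <->
    (exists T X, Om' (T, X) /\ q = (T, X, U (T, X))).

(* Solutions are taken on arbitrary open subdomains, so that local solutions are
   covered as well. *)
Definition maps_to_uniform (J : R -> Prop) (f m : R -> R)
    (Phi : R * R * R -> R * R * R) : Prop :=
  forall (Om Om' : R * R -> Prop) (u U : R * R -> R),
    open Om -> open Om' -> (forall p, Om p -> strip J p) ->
    transforms Phi Om u Om' U ->
    (eb_solution f m Om u <-> uniform_solution Om' U).

Definition explicit_change (f g : R -> R) (k1 k2 k3 : R)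
  : R * R * R -> R * R * R :=
  fun '(t, x, u) =>
    (t + k1, g x + k2, k3 * u * sqrt (f x * (Derive g x) ^ 3)).

(* Main.v *)
Require Import Defs.
From Stdlib Require Import Reals Ranalysis5 Lra Lia ClassicalEpsilon FunctionalExtensionality.
From Coquelicot Require Import Coquelicot.
Open Scope R_scope.

(** With [X = g x] and [U = u sqrt (f g'^3)] the equation becomes
    [U_XXXX + p2 U_XX + p1 U_X + p0 U + U_TT = 0], and the fields [X4] and [X3]
    become [2 d/dX] and [4 T d/dT + 2 X d/dX].  Invariance under the translation
    makes the [p_i] constant, and then invariance under the dilation makes them
    vanish.  Both steps are done at once and in the original variables: the
    determining equation of [X3] minus [g] times that of [X4], evaluated on the jet
    of [c Y(g)] with [c = 1 / sqrt (f g'^3)], is proportional to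
    [2 p2 Y'' + 3 p1 Y' + 4 p0 Y]. *)

(** * Smooth functions of one variable *)

(** The weight is forced: for [u = c Y(g)] the coefficient of [Y'''] vanishes exactly when
    [c'/c = - (f'/f + 3 g''/g') / 2], and [m = g'^4 f] then gives [Y''''] and [U_TT] the same
    factor. The numbers 2, 3, 4 are the weights of [p2], [p1], [p0] under the dilation: up to a
    common factor, [X4] contributes [2 p_i'] and [X3] contributes [2 X p_i' + 2 (4 - i) p_i], so the
    combination removes the derivatives of the [p_i] and no differential equation has to be solved.
    The obstacle is the size of fourth-order expressions in [f], [g] and a square root. Each of [f],
    [g'], [1/g'] and [c] solves some [h' = a h], where [a] is a combination of only two logarithmic
    derivatives, so all higher derivatives are polynomials in these rates times [h]. The [p_i] never
    appear, and what remains is a rational identity whose only denominator is [g']. The class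
    supplies some gauge, in general not the one given in the theorem. Both have the same derivative,
    and the combination above cancels the undifferentiated gauge function. *)

Lemma smooth_is_derive (J : R -> Prop) (h : R -> R) (x : R) :
  smooth J h -> J x -> is_derive h x (Derive h x).
Proof. intros H Hx; apply Derive_correct; exact (H 1%nat x Hx). Qed.

Lemma smooth_Derive (J : R -> Prop) (h : R -> R) :
  smooth J h -> smooth J (Derive h).
Proof.
  intros H [|n] x Hx; [exact I|].
  apply (ex_derive_ext (Derive_n h (S n))); [|exact (H (S (S n)) x Hx)].
  intros y; rewrite <- (Nat.add_1_r n); symmetry; exact (Derive_n_comp h n 1 y).
Qed.

(** Coinduction for smoothness: if every member of [S] has a derivative on [J] that is again in [S],
    then by induction each iterated derivative agrees on [J] with a member of [S]. Openness of [J]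
    lets this agreement pass through [Derive]. No formula for a higher derivative is ever needed. *)
Lemma smooth_coind (J : R -> Prop) (S : (R -> R) -> Prop) :
  open J ->
  (forall h, S h -> exists h', S h' /\ forall x, J x -> is_derive h x (h' x)) ->
  forall h, S h -> smooth J h.
Proof.
  intros HJ Hstep h Hh.
  assert (H : forall n, exists hn, S hn /\ forall x, J x -> Derive_n h n x = hn x).
  { induction n as [|n [hn [Hn En]]]; [exists h; auto|].
    destruct (Hstep hn Hn) as [h' [Hh' Hd]]; exists h'; split; [exact Hh'|].
    intros x Hx; simpl; rewrite (Derive_ext_loc _ hn).
    - apply is_derive_unique, Hd, Hx.
    - apply (filter_imp J); [exact En|exact (HJ x Hx)]. }
  intros [|n] x Hx; [exact I|].
  destruct (H n) as [hn [Hn En]]; destruct (Hstep hn Hn) as [h' [_ Hd]].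
  apply (ex_derive_ext_loc hn).
  - apply (filter_imp J); [intros y Hy; symmetry; exact (En y Hy)|exact (HJ x Hx)].
  - exists (h' x); exact (Hd x Hx).
Qed.

Lemma smooth_const (J : R -> Prop) (c : R) : open J -> smooth J (fun _ => c).
Proof.
  intros HJ; apply (smooth_coind J (fun h => exists c, h = fun _ => c)); [exact HJ| |eauto].
  intros h [d ->]; exists (fun _ => 0); split; [eauto|].
  intros x _; apply (is_derive_const d x).
Qed.

Lemma smooth_id (J : R -> Prop) : open J -> smooth J (fun x => x).
Proof.
  intros HJ.
  apply (smooth_coind J (fun h => h = (fun x => x) \/ smooth J h)); [exact HJ| |auto].
  intros h [->|Hh].
  - exists (fun _ => 1); split; [right; apply smooth_const, HJ|].
    intros x _; apply (is_derive_id x).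
  - exists (Derive h); split; [right; apply smooth_Derive, Hh|].
    intros x Hx; exact (smooth_is_derive J h x Hh Hx).
Qed.

(** A grammar closed under differentiation, as [smooth_coind] demands. The outer function of a
    composite is a smooth function rather than an expression, so its derivative composed with [k]
    stays in the grammar. *)
Inductive smooth_expr (J : R -> Prop) : (R -> R) -> Prop :=
| se_base h : smooth J h -> smooth_expr J h
| se_plus h k : smooth_expr J h -> smooth_expr J k ->
    smooth_expr J (fun x => h x + k x)
| se_mult h k : smooth_expr J h -> smooth_expr J k ->
    smooth_expr J (fun x => h x * k x)
| se_inv h : (forall x, J x -> h x <> 0) -> smooth_expr J h ->
    smooth_expr J (fun x => / h x)
| se_sqrt h : (forall x, J x -> 0 < h x) -> smooth_expr J h ->
    smooth_expr J (fun x => sqrt (h x))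
| se_comp K h k : smooth K h -> (forall x, J x -> K (k x)) -> smooth_expr J k ->
    smooth_expr J (fun x => h (k x)).

Lemma smooth_expr_smooth (J : R -> Prop) (h : R -> R) :
  open J -> smooth_expr J h -> smooth J h.
Proof.
  intros HJ; revert h; apply smooth_coind; [exact HJ|].
  assert (Hc : forall c, smooth_expr J (fun _ => c))
    by (intros c; apply se_base, smooth_const, HJ).
  intros h Hh; induction Hh as
    [h Hh|h k Hh [h' [Eh Dh]] Hk [k' [Ek Dk]]|h k Hh [h' [Eh Dh]] Hk [k' [Ek Dk]]
    |h H0 Hh [h' [Eh Dh]]|h H0 Hh [h' [Eh Dh]]|K h k Hh HK Hk [k' [Ek Dk]]].
  - exists (Derive h); split; [apply se_base, smooth_Derive, Hh|].
    intros x Hx; exact (smooth_is_derive J h x Hh Hx).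
  - exists (fun x => h' x + k' x); split; [apply se_plus; assumption|].
    intros x Hx; exact (is_derive_plus h k x _ _ (Dh x Hx) (Dk x Hx)).
  - exists (fun x => h' x * k x + h x * k' x); split.
    { apply se_plus; apply se_mult; assumption. }
    intros x Hx; apply (is_derive_mult h k x _ _ (Dh x Hx) (Dk x Hx)), Rmult_comm.
  - exists (fun x => -1 * h' x * (/ h x * / h x)); split.
    { apply se_mult; [apply se_mult; auto|apply se_mult; apply se_inv; assumption]. }
    intros x Hx; replace (-1 * h' x * (/ h x * / h x)) with (- h' x / h x ^ 2)
      by (field; exact (H0 x Hx)).
    apply is_derive_inv; auto.
  - assert (Hs : forall x, J x -> sqrt (h x) <> 0)
      by (intros x Hx; apply Rgt_not_eq, sqrt_lt_R0, H0, Hx).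
    exists (fun x => h' x * (/ 2 * / sqrt (h x))); split.
    { apply se_mult; [assumption|apply se_mult; [apply Hc|]].
      apply se_inv; [exact Hs|apply se_sqrt; assumption]. }
    intros x Hx; replace (h' x * (/ 2 * / sqrt (h x))) with (h' x / (2 * sqrt (h x)))
      by (field; exact (Hs x Hx)).
    apply is_derive_sqrt; auto.
  - exists (fun x => k' x * Derive h (k x)); split.
    { apply se_mult; [assumption|].
      apply (se_comp J K); [apply smooth_Derive|..]; assumption. }
    intros x Hx; apply (is_derive_comp h k x); [|exact (Dk x Hx)].
    apply (smooth_is_derive K); auto.
Qed.

(** Nonvanishing and positivity conditions are closed by [assumption]; callers put those facts in
    the context beforehand. *)
Ltac smooth_auto HJ :=
  apply smooth_expr_smooth; [exact HJ|];
  repeat lazymatch goal with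
    | |- smooth_expr _ (fun _ => ?c) => apply se_base, smooth_const; exact HJ
    | |- smooth_expr ?J (fun x => @?h x + @?k x) => apply (se_plus J h k)
    | |- smooth_expr ?J (fun x => @?h x * @?k x) => apply (se_mult J h k)
    | |- smooth_expr ?J (fun x => / @?h x) => apply (se_inv J h); [assumption|]
    | |- smooth_expr ?J (fun x => sqrt (@?h x)) => apply (se_sqrt J h); [assumption|]
    | |- smooth_expr _ _ => apply se_base
    | |- smooth _ (fun x => x) => apply smooth_id; exact HJ
    | |- smooth ?J (fun x => ?h x) => change (smooth J h)
    | |- smooth _ (Derive _) => apply smooth_Derive
    | |- smooth _ _ => assumption
    end.

Lemma smooth_ext (J : R -> Prop) (h k : R -> R) :
  open J -> (forall x, J x -> h x = k x) -> smooth J h -> smooth J k.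
Proof.
  intros HJ E H n x Hx; apply (ex_derive_n_ext_loc h); [|exact (H n x Hx)].
  apply (filter_imp J); [exact E|exact (HJ x Hx)].
Qed.

Lemma open_itv (a b : Rbar) : open (itv a b).
Proof. apply open_and; [apply open_Rbar_gt|apply open_Rbar_lt]. Qed.

(** * The smooth inverse of an increasing function on an open interval *)

Section inverse.
Variables (a b : Rbar) (g : R -> R).
Hypothesis gs : smooth (itv a b) g.
Hypothesis gpos : forall x, itv a b x -> 0 < Derive g x.

Definition image1 (y : R) : Prop := exists x, itv a b x /\ g x = y.

(** Chosen globally on the whole image, so that one function serves for every compact piece on which
    the one-variable inverse function theorem is applied; off the image its value is arbitrary. *)
Definition inverse1 (y : R) : R :=
  epsilon (inhabits 0) (fun x => itv a b x /\ g x = y).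

Lemma inverse1_spec (y : R) : image1 y -> itv a b (inverse1 y) /\ g (inverse1 y) = y.
Proof. exact (epsilon_spec (inhabits 0) (fun x => itv a b x /\ g x = y)). Qed.

Lemma itv_between (x y z : R) : itv a b x -> itv a b z -> x <= y <= z -> itv a b y.
Proof.
  intros [H _] [_ H'] [Hxy Hyz]; split.
  - apply (Rbar_lt_le_trans a x y); assumption.
  - apply (Rbar_le_lt_trans y z b); assumption.
Qed.

Lemma itv_nbhs (x : R) : itv a b x ->
  exists l r, itv a b l /\ itv a b r /\ l < x < r.
Proof.
  intros Hx; destruct (open_itv a b x Hx) as [eps He].
  assert (0 < eps) by apply cond_pos.
  exists (x - eps / 2), (x + eps / 2); repeat split; try lra; apply He;
    unfold ball; simpl; unfold AbsRing_ball, abs, minus, plus, opp; simpl;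
    apply Rabs_def1; lra.
Qed.

Lemma increasing_on_itv (x y : R) : itv a b x -> itv a b y -> x < y -> g x < g y.
Proof.
  intros [Hx _] [_ Hy] Hxy.
  apply (incr_function g a b (Derive g)); try assumption.
  - intros z H1 H2; exact (smooth_is_derive _ g z gs (conj H1 H2)).
  - intros z H1 H2; exact (gpos z (conj H1 H2)).
Qed.

Lemma inverse1_left (x : R) : itv a b x -> inverse1 (g x) = x.
Proof.
  intros Hx; destruct (inverse1_spec (g x)) as [H E]; [exists x; auto|].
  destruct (Rtotal_order (inverse1 (g x)) x) as [Hl|[He|Hl]]; [|exact He|];
    apply increasing_on_itv in Hl; auto; lra.
Qed.

Lemma continuity_on_itv (x : R) : itv a b x -> continuity_pt g x.
Proof.
  intros Hx; apply continuity_pt_filterlim.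
  apply (ex_derive_continuous g x); exists (Derive g x).
  exact (smooth_is_derive _ g x gs Hx).
Qed.

(** By the intermediate value theorem, the image contains a compact interval around [g x] whose ends
    are values of [g]. This gives openness of the image and the closed interval needed to
    differentiate the inverse. *)
Lemma image1_nbhs (x : R) : itv a b x ->
  exists l r, itv a b l /\ itv a b r /\ l < x < r /\
    forall y, g l <= y <= g r -> image1 y.
Proof.
  intros Hx; destruct (itv_nbhs x Hx) as [l [r [Hl [Hr Hlr]]]].
  exists l, r; do 3 (split; [assumption|]); intros y Hy.
  destruct (f_interv_is_interv g l r y) as [z [Hz Ez]]; [lra|exact Hy| |].
  - intros z Hz; apply continuity_on_itv, (itv_between l z r); assumption.
  - exists z; split; [apply (itv_between l z r)|]; assumption.
Qed.

Lemma open_image1 : open image1.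
Proof.
  intros y [x [Hx <-]]; destruct (image1_nbhs x Hx) as [l [r [Hl [Hr [Hlr H]]]]].
  apply (filter_imp (fun z => g l < z /\ z < g r)); [intros z Hz; apply H; lra|].
  apply (open_and _ _ (open_gt (g l)) (open_lt (g r))).
  split; apply increasing_on_itv; tauto.
Qed.

Lemma is_derive_inverse1 (y : R) :
  image1 y -> is_derive inverse1 y (/ Derive g (inverse1 y)).
Proof.
  intros Hy; destruct (inverse1_spec y Hy) as [Hx E].
  destruct (image1_nbhs _ Hx) as [l [r [Hl [Hr [Hlr H]]]]].
  assert (Hlt : g l < y < g r) by (rewrite <- E; split; apply increasing_on_itv; tauto).
  assert (Pd : forall z, inverse1 (g l) <= z <= inverse1 (g r) -> derivable_pt g z).
  { intros z Hz; rewrite !inverse1_left in Hz by assumption.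
    apply ex_derive_Reals_0, (gs 1%nat z), (itv_between l z r); assumption. }
  assert (Hi : inverse1 (g l) <= inverse1 y <= inverse1 (g r)).
  { rewrite !inverse1_left by assumption; lra. }
  assert (Ed : derive_pt g (inverse1 y) (Pd (inverse1 y) Hi) = Derive g (inverse1 y))
    by apply Derive_Reals.
  assert (Hp := gpos _ Hx).
  replace (/ Derive g (inverse1 y))
    with (1 / derive_pt g (inverse1 y) (Pd (inverse1 y) Hi)) by (rewrite Ed; field; lra).
  apply is_derive_Reals, (derivable_pt_lim_recip_interv g inverse1 (g l) (g r) y Pd).
  - apply (continuity_pt_recip_prelim g inverse1 l r); try lra.
    + intros u v Hu Huv Hv; apply increasing_on_itv; [| |exact Huv];
        apply (itv_between l _ r); try assumption; lra.
    + intros u Hu; apply inverse1_left, (itv_between l u r); assumption.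
    + intros u Hu; apply continuity_on_itv, (itv_between l u r); assumption.
  - lra.
  - exact Hlt.
  - intros z Hz; apply inverse1_spec, H, Hz.
  - rewrite Ed; lra.
Qed.

(** The functions [A (inverse1 y)] with [A] smooth are closed under differentiation, since the
    derivative is [(A' / g') (inverse1 y)]; the inverse itself is the case where [A] is the
    identity. *)
Lemma smooth_inverse1 : smooth image1 inverse1.
Proof.
  apply (smooth_coind image1 (fun k => exists A, smooth (itv a b) A /\
    k = fun y => A (inverse1 y))).
  - exact open_image1.
  - intros k [A [HA ->]].
    assert (g0 : forall x, itv a b x -> Derive g x <> 0)
      by (intros x Hx; apply Rgt_not_eq, gpos, Hx).
    exists (fun y => / Derive g (inverse1 y) * Derive A (inverse1 y)); split.
    + exists (fun x => / Derive g x * Derive A x); split; [|reflexivity].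
      smooth_auto (open_itv a b).
    + intros y Hy; apply (is_derive_comp A inverse1); [|apply is_derive_inverse1, Hy].
      apply (smooth_is_derive (itv a b)); [exact HA|apply inverse1_spec, Hy].
  - exists (fun x => x); split; [apply smooth_id, open_itv|reflexivity].
Qed.
End inverse.

(** * Smooth functions of several variables *)

Lemma smooth_continuous (J : R -> Prop) (h : R -> R) (x : R) :
  smooth J h -> J x -> continuous h x.
Proof. intros H Hx; apply (ex_derive_continuous h x), (H 1%nat x Hx). Qed.

Lemma continuous_separable (J : R -> Prop) (D : R * R * R -> Prop) (A B E : R -> R) :
  (forall t x u, D (t, x, u) -> J x) ->
  smooth (fun _ => True) A -> smooth J B -> smooth (fun _ => True) E ->
  forall p, D p -> continuous (fun '(t, x, u) => A t * B x * E u) p.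
Proof.
  intros HD HA HB HE [[t x] u] Hp.
  apply (continuous_ext
    (fun p : R * R * R => A (fst (fst p)) * B (snd (fst p)) * E (snd p)));
    [intros [[? ?] ?]; reflexivity|].
  apply (continuous_mult (K := R_AbsRing)
    (fun p : R * R * R => A (fst (fst p)) * B (snd (fst p))) (fun p => E (snd p)));
    [apply (continuous_mult (K := R_AbsRing)
      (fun p : R * R * R => A (fst (fst p))) (fun p => B (snd (fst p))))|].
  - apply (continuous_comp (fun p : R * R * R => fst (fst p)) A);
      [apply (continuous_comp fst fst); apply continuous_fst
      |exact (smooth_continuous _ A t HA I)].
  - apply (continuous_comp (fun p : R * R * R => snd (fst p)) B);
      [apply (continuous_comp fst snd); [apply continuous_fst|apply continuous_snd]
      |exact (smooth_continuous _ B x HB (HD t x u Hp))].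
  - apply (continuous_comp (fun p : R * R * R => snd p) E);
      [apply continuous_snd|exact (smooth_continuous _ E u HE I)].
Qed.

(** Products [A t * B x * E u] are stable under all three partial derivatives. Every component of
    the vector fields and of the explicit change and its inverse has this shape. *)
Lemma C3_separable (J : R -> Prop) (D : R * R * R -> Prop) (k : nat) (A B E : R -> R) :
  (forall t x u, D (t, x, u) -> J x) ->
  smooth (fun _ => True) A -> smooth J B -> smooth (fun _ => True) E ->
  C3 k D (fun '(t, x, u) => A t * B x * E u).
Proof.
  intros HD; revert A B E; induction k as [|k IH]; intros A B E HA HB HE.
  all: split; [apply (continuous_separable J); assumption|try exact I].
  (* [Derive] is total and commutes with constant factors unconditionally, so these are equalities
     of functions on the whole space and can be rewritten under [C3]. *)
  assert (Et : (fun '(t, x, u) => Derive (fun s => A s * B x * E u) t)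
               = (fun '(t, x, u) => Derive A t * B x * E u)).
  { apply functional_extensionality; intros [[t x] u].
    rewrite !Derive_scal_l; reflexivity. }
  assert (Ex : (fun '(t, x, u) => Derive (fun y => A t * B y * E u) x)
               = (fun '(t, x, u) => A t * Derive B x * E u)).
  { apply functional_extensionality; intros [[t x] u].
    rewrite Derive_scal_l, Derive_scal; reflexivity. }
  assert (Eu : (fun '(t, x, u) => Derive (fun w => A t * B x * E w) u)
               = (fun '(t, x, u) => A t * B x * Derive E u)).
  { apply functional_extensionality; intros [[t x] u]; apply Derive_scal. }
  split; [|split; [|split; [|split; [|split]]]].
  - intros t x u Hp; auto_derive; repeat split; exact (HA 1%nat t I).
  - intros t x u Hp; auto_derive; repeat split; exact (HB 1%nat x (HD t x u Hp)).
  - intros t x u Hp; auto_derive; repeat split; exact (HE 1%nat u I).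
  - cbv beta; rewrite Et; apply IH; [apply smooth_Derive; exact HA|exact HB|exact HE].
  - cbv beta; rewrite Ex; apply IH; [exact HA|apply smooth_Derive; exact HB|exact HE].
  - cbv beta; rewrite Eu; apply IH; [exact HA|exact HB|apply smooth_Derive; exact HE].
Qed.

Lemma smooth3_separable (J : R -> Prop) (D : R * R * R -> Prop)
    (A B E : R -> R) (F : R * R * R -> R) :
  (forall t x u, D (t, x, u) -> J x) ->
  smooth (fun _ => True) A -> smooth J B -> smooth (fun _ => True) E ->
  (forall t x u, F (t, x, u) = A t * B x * E u) -> smooth3 D F.
Proof.
  intros HD HA HB HE EF k.
  replace F with (fun '(t, x, u) => A t * B x * E u).
  - apply (C3_separable J); assumption.
  - apply functional_extensionality; intros [[t x] u]; symmetry; apply EF.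
Qed.

Lemma open_slice_t (D : R * R -> Prop) (t x : R) :
  open D -> D (t, x) -> locally t (fun s => D (s, x)).
Proof.
  intros HD Hp; destruct (HD _ Hp) as [eps He]; exists eps; intros s Hs.
  apply He; split; [exact Hs|apply ball_center].
Qed.

Lemma open_slice_x (D : R * R -> Prop) (t x : R) :
  open D -> D (t, x) -> locally x (fun y => D (t, y)).
Proof.
  intros HD Hp; destruct (HD _ Hp) as [eps He]; exists eps; intros s Hs.
  apply He; split; [apply ball_center|exact Hs].
Qed.

Lemma C2_ext (k : nat) (D : R * R -> Prop) (u v : R * R -> R) :
  open D -> (forall p, D p -> u p = v p) -> C2 k D u -> C2 k D v.
Proof.
  intros HD; revert u v; induction k as [|k IH]; intros u v E [Hc Hk];
    (split; [intros p Hp; apply (continuous_ext_loc v u p);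
       [apply (filter_imp D); [exact E|exact (HD p Hp)]|exact (Hc p Hp)]|]);
    [exact I|].
  assert (Lt : forall t x, D (t, x) -> locally t (fun s => u (s, x) = v (s, x)))
    by (intros t x Hp; apply (filter_imp (fun s => D (s, x)));
        [intros; apply E; assumption|apply open_slice_t; assumption]).
  assert (Lx : forall t x, D (t, x) -> locally x (fun y => u (t, y) = v (t, y)))
    by (intros t x Hp; apply (filter_imp (fun y => D (t, y)));
        [intros; apply E; assumption|apply open_slice_x; assumption]).
  destruct Hk as [Ht [Hx [HDt HDx]]]; split; [|split; [|split]].
  - intros t x Hp; apply (ex_derive_ext_loc (fun s => u (s, x))); auto.
  - intros t x Hp; apply (ex_derive_ext_loc (fun y => u (t, y))); auto.
  - refine (IH _ _ _ HDt); intros [t x] Hp; apply Derive_ext_loc, Lt, Hp.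
  - refine (IH _ _ _ HDx); intros [t x] Hp; apply Derive_ext_loc, Lx, Hp.
Qed.

Lemma C2_plus (k : nat) (D : R * R -> Prop) (u v : R * R -> R) :
  open D -> C2 k D u -> C2 k D v -> C2 k D (fun p => u p + v p).
Proof.
  intros HD; revert u v; induction k as [|k IH]; intros u v [Hc Hk] [Hc' Hk'];
    (split; [intros p Hp; apply (continuous_plus (V := R_NormedModule) u v p); auto|]); [exact I|].
  destruct Hk as [Ht [Hx [HDt HDx]]], Hk' as [Ht' [Hx' [HDt' HDx']]]; split; [|split; [|split]].
  - intros t x Hp; apply (ex_derive_plus (fun s => u (s, x)) (fun s => v (s, x))); auto.
  - intros t x Hp; apply (ex_derive_plus (fun y => u (t, y)) (fun y => v (t, y))); auto.
  - refine (C2_ext k D _ _ HD _ (IH _ _ HDt HDt')); intros [t x] Hp; symmetry.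
    apply Derive_plus; auto.
  - refine (C2_ext k D _ _ HD _ (IH _ _ HDx HDx')); intros [t x] Hp; symmetry.
    apply Derive_plus; auto.
Qed.

Lemma C2_pred (k : nat) (D : R * R -> Prop) (u : R * R -> R) : C2 (S k) D u -> C2 k D u.
Proof.
  revert u; induction k as [|k IH]; intros u [Hc H]; (split; [exact Hc|]); [exact I|].
  destruct H as [Ht [Hx [HDt HDx]]]; repeat split; auto.
Qed.

(** Up to sums, the functions [c x * U (t + d, G x)] are stable under both partial derivatives: d/dx
    gives [c' U + c G' U_X], two terms of the same shape. Hence [c] and [U] are generalized in the
    induction. *)
Lemma C2_change (k : nat) (J : R -> Prop) (Om Om' : R * R -> Prop)
    (d : R) (c G : R -> R) (U : R * R -> R) :
  open J -> open Om -> (forall t x, Om (t, x) -> J x) ->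
  smooth J c -> smooth J G -> (forall t x, Om (t, x) -> Om' (t + d, G x)) ->
  C2 k Om' U -> C2 k Om (fun '(t, x) => c x * U (t + d, G x)).
Proof.
  intros HJ HO HOJ Hc HG HOO; revert c Hc U; induction k as [|k IH];
    intros c Hc U [HU Hk].
  all: split; [|try exact I].
  1, 2: intros [t x] Hp;
    apply (continuous_ext (fun p : R * R => c (snd p) * U (fst p + d, G (snd p))));
      [intros [? ?]; reflexivity|];
    apply (continuous_mult (K := R_AbsRing)
      (fun p : R * R => c (snd p)) (fun p => U (fst p + d, G (snd p))));
    [apply (continuous_comp (fun p : R * R => snd p) c);
       [apply continuous_snd|exact (smooth_continuous J c x Hc (HOJ t x Hp))]|];
    apply (continuous_comp_2 (fun p : R * R => fst p + d) (fun p : R * R => G (snd p))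
      (fun a b => U (a, b)));
    [apply (continuous_plus (fun p : R * R => fst p) (fun _ => d));
       [apply continuous_fst|apply continuous_const]
    |apply (continuous_comp (fun p : R * R => snd p) G);
       [apply continuous_snd|exact (smooth_continuous J G x HG (HOJ t x Hp))]
    |apply (continuous_ext U); [intros [? ?]; reflexivity|exact (HU _ (HOO t x Hp))]].
  destruct Hk as [Ht [Hx [HDt HDx]]].
  assert (Dx : forall t x, Om (t, x) -> is_derive (fun y => c y * U (t + d, G y)) x
    (Derive c x * U (t + d, G x)
     + c x * Derive G x * Derive (fun y => U (t + d, y)) (G x))).
  { intros t x Hp; assert (Jx := HOJ t x Hp).
    replace (c x * Derive G x * Derive (fun y => U (t + d, y)) (G x))
      with (c x * (Derive G x * Derive (fun y => U (t + d, y)) (G x))) by ring.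
    apply (is_derive_mult c (fun y => U (t + d, G y)));
      [exact (smooth_is_derive J c x Hc Jx)| |exact Rmult_comm].
    apply (is_derive_comp (fun y => U (t + d, y)) G);
      [|exact (smooth_is_derive J G x HG Jx)].
    apply Derive_correct, Hx, HOO, Hp. }
  split; [|split; [|split]].
  - intros t x Hp.
    assert (H : is_derive (fun s => U (s + d, G x)) t
      (1 * Derive (fun s => U (s, G x)) (t + d))).
    { apply (is_derive_comp (fun s => U (s, G x)) (fun s => s + d)).
      - apply Derive_correct, Ht, HOO, Hp.
      - auto_derive; [exact I|ring]. }
    apply (ex_derive_scal (fun s => U (s + d, G x)) (c x)); eexists; exact H.
  - intros t x Hp; eexists; exact (Dx t x Hp).
  - replace (fun '(t, x) => Derive (fun s => c x * U (s + d, G x)) t)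
      with (fun '(t, x) =>
        c x * (fun '(t, x) => Derive (fun s => U (s, x)) t) (t + d, G x)).
    + exact (IH c Hc _ HDt).
    + apply functional_extensionality; intros [t x]; rewrite Derive_scal; f_equal.
      symmetry; exact (Derive_n_comp_trans (fun s => U (s, G x)) 1 t d).
  (* In [c' U + c G' U_X] the first term keeps [U] itself, whose regularity is lowered by one; the
     second uses the regularity of [U_X]. *)
  - refine (C2_ext k Om _ _ HO _ (C2_plus k Om _ _ HO
      (IH (Derive c) (smooth_Derive J c Hc) U (C2_pred k Om' U _))
      (IH (fun x => c x * Derive G x) _ _ HDx))).
    + intros [t x] Hp; symmetry; apply is_derive_unique, Dx, Hp.
    + exact (conj HU (conj Ht (conj Hx (conj HDt HDx)))).
    + smooth_auto HJ.
Qed.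

(** * Jets and the determining equation *)

(** The derivatives are named functions instead of [Derive_n], so they can be given as polynomials
    in logarithmic derivatives, in exactly the form that the algebraic identity expects. *)
Definition chain4 (J : R -> Prop) (h0 h1 h2 h3 h4 : R -> R) : Prop :=
  forall x, J x ->
    is_derive h0 x (h1 x) /\ is_derive h1 x (h2 x) /\
    is_derive h2 x (h3 x) /\ is_derive h3 x (h4 x).

Ltac chain_derive :=
  repeat match goal with
  | H : chain4 ?J _ _ _ _ _, Hx : ?J ?x |- is_derive _ ?x _ =>
      let H0 := fresh in let H1 := fresh in let H2 := fresh in let H3 := fresh in
      destruct (H x Hx) as [H0 [H1 [H2 H3]]]; clear H
  end;
  auto_derive;
  [repeat split; try (eexists; eassumption)
  |repeat match goal with
   | H : is_derive ?h ?x _ |- _ => rewrite ?(is_derive_unique (fun y : R => h y) x _ H); clear H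
   end; try ring].

Lemma upd_same (p : jet) (c : coord) (s : R) : upd p c s c = s.
Proof. unfold upd; destruct (coord_eq_dec c c); [reflexivity|contradiction]. Qed.

Lemma upd_other (p : jet) (c d : coord) (s : R) : c <> d -> upd p c s d = p d.
Proof. intros H; unfold upd; destruct (coord_eq_dec c d); [contradiction|reflexivity]. Qed.

Lemma pd_indep (c : coord) (F : jet -> R) (p : jet) :
  (forall s, F (upd p c s) = F p) -> pd c F p = 0.
Proof.
  intros H; unfold pd; rewrite (Derive_ext _ (fun _ => F p)) by exact H.
  apply Derive_const.
Qed.

(** Varying [cx] stays inside the open set [J] for a while, and varying any other coordinate does
    not move [p cx]; so agreement over [J] suffices. *)
Lemma pd_local (J : R -> Prop) (c : coord) (F G : jet -> R) (p : jet) :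
  open J -> (forall q, J (q cx) -> F q = G q) -> J (p cx) -> pd c F p = pd c G p.
Proof.
  intros HJ E Hp; apply Derive_ext_loc.
  destruct (coord_eq_dec c cx) as [->|Hc].
  - apply (filter_imp J); [|exact (HJ _ Hp)].
    intros s Hs; apply E; rewrite upd_same; exact Hs.
  - apply filter_forall; intros s; apply E; rewrite upd_other by exact Hc; exact Hp.
Qed.

Lemma sum_order_ext (n : nat) (G H : nat -> nat -> R) :
  (forall i j, G i j = H i j) -> sum_order n G = sum_order n H.
Proof. intros E; apply sum_eq; intros i _; apply sum_eq; intros j _; apply E. Qed.

Lemma sum_order_row0 (n : nat) (G : nat -> nat -> R) :
  (forall i j, G (S i) j = 0) -> sum_order n G = sum_f_R0 (G 0%nat) n.
Proof.
  intros H; unfold sum_order; destruct n as [|n]; [reflexivity|].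
  rewrite decomp_sum by lia; rewrite Nat.sub_0_r.
  rewrite <- (Rplus_0_r (sum_f_R0 (G 0%nat) (S n))); apply f_equal2; [reflexivity|].
  rewrite (sum_eq _ (fun _ => 0)); [rewrite sum_cte; ring|].
  intros i _; rewrite (sum_eq _ (fun _ => 0)); [rewrite sum_cte; ring|].
  intros j _; apply H.
Qed.

Lemma totDx_local (J : R -> Prop) (n : nat) (F G : jet -> R) (p : jet) :
  open J -> (forall q, J (q cx) -> F q = G q) -> J (p cx) ->
  totDx n F p = totDx n G p.
Proof.
  intros HJ E Hp; unfold totDx; f_equal; [exact (pd_local J cx F G p HJ E Hp)|].
  apply sum_order_ext; intros i j; f_equal; exact (pd_local J _ F G p HJ E Hp).
Qed.

Lemma totDt_0 (F : jet -> R) (p : jet) :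
  totDt 0 F p = pd ct F p + p (cu 1 0) * pd (cu 0 0) F p.
Proof. reflexivity. Qed.

Lemma totDx_0 (F : jet -> R) (p : jet) :
  totDx 0 F p = pd cx F p + p (cu 0 1) * pd (cu 0 0) F p.
Proof. reflexivity. Qed.

(** Differential expressions linear in [u], [u_x], ... with coefficients in [x]. [totDx] sends order
    [n] to order [n + 1]; the equation apart from [u_tt], and the pure x-prolongations of the fields
    in question, are of this form. *)
Definition lin (n : nat) (a : nat -> R -> R) : jet -> R :=
  fun p => sum_f_R0 (fun j => a j (p cx) * p (cu 0 j)) n.

Lemma lin_upd_other (n : nat) (a : nat -> R -> R) (p : jet) (c : coord) (s : R) :
  c <> cx -> (forall j, (j <= n)%nat -> c <> cu 0 j) ->
  lin n a (upd p c s) = lin n a p.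
Proof.
  intros Hx Hu; apply sum_eq; intros j Hj; rewrite !upd_other; auto.
Qed.

Lemma is_derive_lin_cx (n : nat) (a a' : nat -> R -> R) (p : jet) :
  (forall j, (j <= n)%nat -> is_derive (a j) (p cx) (a' j (p cx))) ->
  is_derive (fun s => lin n a (upd p cx s)) (p cx) (lin n a' p).
Proof.
  intros H.
  assert (T : forall j, (j <= n)%nat ->
    is_derive (fun s => a j (upd p cx s cx) * upd p cx s (cu 0 j)) (p cx)
      (a' j (p cx) * p (cu 0 j))).
  { intros j Hj; rewrite Rmult_comm.
    apply (is_derive_ext (fun s => p (cu 0 j) * a j s));
      [intros s; rewrite upd_same, upd_other by discriminate; apply Rmult_comm|].
    apply is_derive_scal, H, Hj. }
  clear H; unfold lin; induction n as [|n IH]; simpl; [apply T, Nat.le_refl|].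
  apply (is_derive_plus (fun s => sum_f_R0 _ n)); [apply IH; auto|apply T, Nat.le_refl].
Qed.

Lemma is_derive_lin_cu (n j : nat) (a : nat -> R -> R) (p : jet) :
  (j <= n)%nat ->
  is_derive (fun s => lin n a (upd p (cu 0 j) s)) (p (cu 0 j)) (a j (p cx)).
Proof.
  intros Hj; assert (E : forall s,
    a j (p cx) * s + (lin n a p - a j (p cx) * p (cu 0 j)) = lin n a (upd p (cu 0 j) s)).
  { intros s; revert Hj; unfold lin; induction n as [|n IH]; intros Hj.
    - assert (j = 0)%nat as -> by lia; simpl.
      rewrite upd_same, upd_other by discriminate; ring.
    - destruct (Nat.eq_dec j (S n)) as [->|Hn].
      + simpl; assert (E := lin_upd_other n a p (cu 0 (S n)) s).
        unfold lin in E; rewrite E; [|discriminate|intros i Hi [=]; lia].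
        rewrite upd_same, upd_other by discriminate; ring.
      + simpl; rewrite <- IH by lia; rewrite !upd_other; [ring|intros [=]; lia|discriminate]. }
  apply (is_derive_ext _ _ _ _ E); auto_derive; [exact I|ring].
Qed.

Lemma totDx_lin (n : nat) (a a' : nat -> R -> R) (p : jet) :
  (forall j, (j <= n)%nat -> is_derive (a j) (p cx) (a' j (p cx))) ->
  totDx n (lin n a) p =
  sum_f_R0 (fun j => a' j (p cx) * p (cu 0 j) + a j (p cx) * p (cu 0 (S j))) n.
Proof.
  intros H; unfold totDx; rewrite sum_order_row0.
  - replace (pd cx (lin n a) p) with (lin n a' p)
      by (symmetry; apply is_derive_unique, is_derive_lin_cx, H).
    unfold lin at 1; rewrite <- plus_sum; apply sum_eq; intros j Hj; f_equal.
    replace (pd (cu 0 j) (lin n a) p) with (a j (p cx))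
      by (symmetry; apply is_derive_unique, is_derive_lin_cu, Hj); ring.
  - intros i j; rewrite pd_indep; [ring|].
    intros s; apply lin_upd_other; discriminate.
Qed.

Definition coefs (h0 h1 h2 h3 h4 : R -> R) (j : nat) : R -> R :=
  match j with
  | 0%nat => h0 | 1%nat => h1 | 2%nat => h2 | 3%nat => h3 | _ => h4
  end.

(* [(f y'')''] *)
Definition bending (f f1 f2 y2 y3 y4 : R) : R := f * y4 + 2 * f1 * y3 + f2 * y2.

(* Invariance condition for [al t d/dt + xi d/dx + ph u d/du], after eliminating [u_tt]
   by means of the equation; [mu] is [m'/m] and [yj] is the j-th x-derivative of [u]. *)
Definition determining (al mu f f1 f2 f3 xi xi1 xi2 xi3 xi4 ph ph1 ph2 ph3 ph4
    y0 y1 y2 y3 y4 : R) : R :=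
  xi * bending f1 f2 f3 y2 y3 y4
  + f2 * (ph2 * y0 + (2 * ph1 - xi2) * y1 + (ph - 2 * xi1) * y2)
  + 2 * f1 * (ph3 * y0 + (3 * ph2 - xi3) * y1 + (3 * ph1 - 3 * xi2) * y2
              + (ph - 3 * xi1) * y3)
  + f * (ph4 * y0 + (4 * ph3 - xi4) * y1 + (6 * ph2 - 4 * xi3) * y2
         + (4 * ph1 - 6 * xi2) * y3 + (ph - 4 * xi1) * y4)
  - (xi * mu + ph - 2 * al) * bending f f1 f2 y2 y3 y4.

(** * Prolongation of a field linear in [u], and its invariance condition *)

Section jets.
Variables (J : R -> Prop) (f f1 f2 f3 f4 m mu : R -> R).
Hypothesis HJ : open J.
Hypothesis Hf : chain4 J f f1 f2 f3 f4.
Hypothesis Hm : forall x, J x -> 0 < m x /\ is_derive m x (mu x * m x).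

Let z : R -> R := fun _ => 0.

Lemma is_derive_zero (x : R) : is_derive z x (z x).
Proof. apply (is_derive_const (K := R_AbsRing) (V := R_NormedModule)). Qed.

Lemma eb_jet_explicit (p : jet) : J (p cx) ->
  eb_jet f m p = lin 4 (coefs z z f2 (fun x => 2 * f1 x) f) p + m (p cx) * p (cu 2 0).
Proof.
  intros Hp; unfold eb_jet; f_equal.
  rewrite (totDx_local J 3 _ (lin 3 (coefs z z f1 f z)) p HJ); [|clear p Hp|exact Hp].
  - rewrite (totDx_lin 3 _ (coefs z z f2 f1 z)).
    + unfold lin; simpl; unfold z; ring.
    + destruct (Hf _ Hp) as [H0 [H1 [H2 H3]]].
      intros [|[|[|[|j]]]] _; simpl; auto using is_derive_zero.
  - intros p Hp.
    rewrite (totDx_local J 2 _ (lin 2 (coefs z z f z z)) p HJ); [| |exact Hp].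
    + rewrite (totDx_lin 2 _ (coefs z z f1 z z)).
      * unfold lin; simpl; unfold z; ring.
      * destruct (Hf _ Hp) as [H0 [H1 [H2 H3]]].
        intros [|[|[|[|j]]]] _; simpl; auto using is_derive_zero.
    + intros q _; unfold lin; simpl; unfold z; ring.
Qed.

Variables (al : R) (xi xi1 xi2 xi3 xi4 ph ph1 ph2 ph3 ph4 : R -> R).
Hypothesis Hxi : chain4 J xi xi1 xi2 xi3 xi4.
Hypothesis Hph : chain4 J ph ph1 ph2 ph3 ph4.

Let v : vfield := VField (fun '(t, x, u) => al * t) (fun '(t, x, u) => xi x)
                         (fun '(t, x, u) => ph x * u).

Lemma totDx0_vt (p : jet) : totDx 0 (on_jet (vt v)) p = 0.
Proof. rewrite totDx_0, !pd_indep by (intros s; reflexivity); ring. Qed.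

Lemma totDt0_vt (p : jet) : totDt 0 (on_jet (vt v)) p = al.
Proof.
  rewrite totDt_0, (pd_indep (cu 0 0)) by (intros s; reflexivity).
  replace (pd ct (on_jet (vt v)) p) with al; [ring|symmetry].
  apply (is_derive_unique (fun s => al * s) (p ct) al); auto_derive; [exact I|ring].
Qed.

Lemma totDx0_vx (p : jet) : J (p cx) -> totDx 0 (on_jet (vx v)) p = xi1 (p cx).
Proof.
  intros Hp; rewrite totDx_0, (pd_indep (cu 0 0)) by (intros s; reflexivity).
  replace (pd cx (on_jet (vx v)) p) with (xi1 (p cx)); [ring|symmetry].
  apply (is_derive_unique xi (p cx)), Hxi, Hp.
Qed.

Lemma totDt0_vx (p : jet) : totDt 0 (on_jet (vx v)) p = 0.
Proof. rewrite totDt_0, !pd_indep by (intros s; reflexivity); ring. Qed.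

Lemma prol_t1 (p : jet) : prol_t v 1 p = (ph (p cx) - al) * p (cu 1 0).
Proof.
  change (totDt 0 (on_jet (vu v)) p - p (cu 1 0) * totDt 0 (on_jet (vt v)) p
    - p (cu 0 1) * totDt 0 (on_jet (vx v)) p = (ph (p cx) - al) * p (cu 1 0)).
  rewrite totDt0_vt, totDt0_vx, totDt_0, (pd_indep ct) by (intros s; reflexivity).
  replace (pd (cu 0 0) (on_jet (vu v)) p) with (ph (p cx)); [ring|symmetry].
  apply (is_derive_unique (fun s => ph (p cx) * s)); auto_derive; [exact I|ring].
Qed.

Lemma prol_t2 (p : jet) : prol_t v 2 p = (ph (p cx) - 2 * al) * p (cu 2 0).
Proof.
  change (totDt 1 (prol_t v 1) p - p (cu 2 0) * totDt 0 (on_jet (vt v)) p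
    - p (cu 1 1) * totDt 0 (on_jet (vx v)) p = (ph (p cx) - 2 * al) * p (cu 2 0)).
  rewrite totDt0_vt, totDt0_vx.
  replace (prol_t v 1) with (fun p : jet => (ph (p cx) - al) * p (cu 1 0))
    by (apply functional_extensionality; intros q; symmetry; apply prol_t1).
  unfold totDt, sum_order, sum_f_R0, Nat.sub.
  rewrite (pd_indep ct), (pd_indep (cu 0 0)), (pd_indep (cu 0 1))
    by (intros s; reflexivity).
  replace (pd (cu 1 0) (fun p : jet => (ph (p cx) - al) * p (cu 1 0)) p)
    with (ph (p cx) - al); [ring|symmetry].
  apply (is_derive_unique (fun s => (ph (p cx) - al) * s)); auto_derive; [exact I|ring].
Qed.

(** The t-component depends on [t] alone, so its [totDx] vanishes and the mixed coordinate [cu 1 n]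
    drops out. This keeps the recursion within [lin]. *)
Lemma prol_x_step (n : nat) (a a' b : nat -> R -> R) :
  (forall q, J (q cx) -> prol_coef v 0 n q = lin n a q) ->
  (forall x j, J x -> (j <= n)%nat -> is_derive (a j) x (a' j x)) ->
  (forall q, J (q cx) ->
    sum_f_R0 (fun j => a' j (q cx) * q (cu 0 j) + a j (q cx) * q (cu 0 (S j))) n
    - q (cu 0 (S n)) * xi1 (q cx) = lin (S n) b q) ->
  forall q, J (q cx) -> prol_coef v 0 (S n) q = lin (S n) b q.
Proof.
  intros Ha Hd Hb q Hq; rewrite <- Hb by exact Hq.
  change (totDx n (prol_coef v 0 n) q - q (cu 1 n) * totDx 0 (on_jet (vt v)) q
    - q (cu 0 (S n)) * totDx 0 (on_jet (vx v)) q
    = sum_f_R0 (fun j => a' j (q cx) * q (cu 0 j) + a j (q cx) * q (cu 0 (S j))) n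
      - q (cu 0 (S n)) * xi1 (q cx)).
  rewrite totDx0_vt, (totDx0_vx q Hq).
  rewrite (totDx_local J n _ (lin n a) q HJ Ha Hq), (totDx_lin n a a') by auto; ring.
Qed.

Lemma prol_x0 (q : jet) : J (q cx) ->
  prol_coef v 0 0 q = lin 0 (coefs ph z z z z) q.
Proof. intros _; reflexivity. Qed.

Lemma prol_x1 (q : jet) : J (q cx) ->
  prol_coef v 0 1 q = lin 1 (coefs ph1 (fun x => ph x - xi1 x) z z z) q.
Proof.
  apply (prol_x_step 0 _ (coefs ph1 z z z z) _ prol_x0).
  - intros x [|j] Hx Hj; [apply Hph, Hx|lia].
  - intros p Hp; unfold lin; simpl; ring.
Qed.

Lemma prol_x2 (q : jet) : J (q cx) ->
  prol_coef v 0 2 q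
  = lin 2 (coefs ph2 (fun x => 2 * ph1 x - xi2 x) (fun x => ph x - 2 * xi1 x) z z) q.
Proof.
  apply (prol_x_step 1 _ (coefs ph2 (fun x => ph1 x - xi2 x) z z z) _ prol_x1).
  - intros x [|[|j]] Hx Hj; [apply Hph, Hx| |lia].
    apply (is_derive_minus ph xi1); [apply Hph, Hx|apply Hxi, Hx].
  - intros p Hp; unfold lin; simpl; ring.
Qed.

Lemma prol_x3 (q : jet) : J (q cx) ->
  prol_coef v 0 3 q
  = lin 3 (coefs ph3 (fun x => 3 * ph2 x - xi3 x) (fun x => 3 * ph1 x - 3 * xi2 x)
             (fun x => ph x - 3 * xi1 x) z) q.
Proof.
  apply (prol_x_step 2 _ (coefs ph3 (fun x => 2 * ph2 x - xi3 x)
    (fun x => ph1 x - 2 * xi2 x) z z) _ prol_x2).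
  - intros x [|[|[|j]]] Hx Hj; [apply Hph, Hx| | |lia]; simpl; chain_derive.
  - intros p Hp; unfold lin; simpl; ring.
Qed.

(** By the Leibniz rule, at order [n] the coefficient of [u_k] is [binom(n,k) ph^(n-k) -
    binom(n,k-1) xi^(n-k+1)]; here [n = 4]. *)
Lemma prol_x4 (q : jet) : J (q cx) ->
  prol_coef v 0 4 q
  = lin 4 (coefs ph4 (fun x => 4 * ph3 x - xi4 x) (fun x => 6 * ph2 x - 4 * xi3 x)
             (fun x => 4 * ph1 x - 6 * xi2 x) (fun x => ph x - 4 * xi1 x)) q.
Proof.
  apply (prol_x_step 3 _ (coefs ph4 (fun x => 3 * ph3 x - xi4 x)
    (fun x => 3 * ph2 x - 3 * xi3 x) (fun x => ph1 x - 3 * xi2 x) z) _ prol_x3).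
  - intros x [|[|[|[|j]]]] Hx Hj; [apply Hph, Hx| | | |lia]; simpl; chain_derive.
  - intros p Hp; unfold lin; simpl; ring.
Qed.

Let eb (p : jet) : R :=
  lin 4 (coefs z z f2 (fun x => 2 * f1 x) f) p + m (p cx) * p (cu 2 0).

Lemma pd_eb_x (p : jet) : J (p cx) ->
  pd cx eb p
  = lin 4 (coefs z z f3 (fun x => 2 * f2 x) f1) p + mu (p cx) * m (p cx) * p (cu 2 0).
Proof.
  intros Hp; apply is_derive_unique.
  apply (is_derive_plus (fun s => lin 4 _ (upd p cx s))).
  - apply (is_derive_lin_cx 4 (coefs z z f2 (fun x => 2 * f1 x) f)
      (coefs z z f3 (fun x => 2 * f2 x) f1)).
    destruct (Hf _ Hp) as [H0 [H1 [H2 _]]].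
    intros [|[|[|[|j]]]] _; simpl; auto using is_derive_zero, is_derive_scal.
  - rewrite Rmult_comm; apply (is_derive_ext (fun s => p (cu 2 0) * m s));
      [intros s; rewrite upd_same, upd_other by discriminate; apply Rmult_comm|].
    apply is_derive_scal, Hm, Hp.
Qed.

Lemma pd_eb_u0 (j : nat) (p : jet) : (j <= 4)%nat ->
  pd (cu 0 j) eb p = coefs z z f2 (fun x => 2 * f1 x) f j (p cx).
Proof.
  intros Hj; apply is_derive_unique.
  rewrite <- (Rplus_0_r (coefs _ _ _ _ _ _ _)).
  apply (is_derive_plus (fun s => lin 4 _ (upd p (cu 0 j) s))
    (fun s => m (upd p (cu 0 j) s cx) * upd p (cu 0 j) s (cu 2 0))).
  - apply is_derive_lin_cu, Hj.
  - apply (is_derive_ext (fun _ => m (p cx) * p (cu 2 0)));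
      [intros s; rewrite !upd_other by discriminate; reflexivity|].
    apply (is_derive_const (K := R_AbsRing) (V := R_NormedModule)).
Qed.

Lemma pd_eb_u20 (p : jet) : pd (cu 2 0) eb p = m (p cx).
Proof.
  apply is_derive_unique.
  apply (is_derive_ext (fun s => m (p cx) * s
    + lin 4 (coefs z z f2 (fun x => 2 * f1 x) f) p)).
  - intros s; unfold eb; rewrite lin_upd_other by discriminate.
    rewrite upd_same, upd_other by discriminate; apply Rplus_comm.
  - auto_derive; [exact I|ring].
Qed.

Lemma pd_eb_other (i j : nat) (p : jet) :
  cu i j <> cu 2 0 -> (forall k, (k <= 4)%nat -> cu i j <> cu 0 k) ->
  pd (cu i j) eb p = 0.
Proof.
  intros H2 H0; apply pd_indep; intros s; unfold eb.
  rewrite lin_upd_other, !upd_other by (exact H0 || exact H2 || discriminate); reflexivity.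
Qed.

Lemma prolong_eb (p : jet) : J (p cx) ->
  prolong 4 v (eb_jet f m) p =
  xi (p cx) * pd cx eb p
  + prol_coef v 0 2 p * f2 (p cx) + prol_coef v 0 3 p * (2 * f1 (p cx))
  + prol_coef v 0 4 p * f (p cx) + prol_t v 2 p * m (p cx).
Proof.
  intros Hp; unfold prolong.
  assert (L : forall c, pd c (eb_jet f m) p = pd c eb p)
    by (intros c; apply (pd_local J); [exact HJ|exact eb_jet_explicit|exact Hp]).
  rewrite !L, (sum_order_ext _ _ (fun i j => prol_coef v i j p * pd (cu i j) eb p))
    by (intros i j; rewrite L; reflexivity).
  unfold sum_order, sum_f_R0, Nat.sub.
  rewrite !pd_eb_u0, pd_eb_u20 by lia.
  rewrite (pd_indep ct) by (intros s; reflexivity).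
  rewrite !pd_eb_other by (discriminate || (intros k _; discriminate)).
  change (on_jet (vx v) p) with (xi (p cx)); change (prol_coef v 2 0 p) with (prol_t v 2 p).
  cbn [coefs]; unfold z; ring.
Qed.

(** Since [m > 0], the equation can be solved for [u_tt], which leaves the x-derivatives of [u] at
    the point free. The condition therefore holds for arbitrary [y0], ..., [y4]. *)
Lemma symmetry_determining (x y0 y1 y2 y3 y4 : R) :
  J x -> eb_symmetry J f m v ->
  determining al (mu x) (f x) (f1 x) (f2 x) (f3 x) (xi x) (xi1 x) (xi2 x) (xi3 x) (xi4 x)
    (ph x) (ph1 x) (ph2 x) (ph3 x) (ph4 x) y0 y1 y2 y3 y4 = 0.
Proof.
  intros Hx [_ H]; assert (Hm0 := proj1 (Hm x Hx)).
  (* The value of [cu 2 0] puts the jet on the equation; the coordinates set to 0 do not occur in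
     the prolonged condition. *)
  pose (p := fun c => match c with
    | cx => x
    | cu 0 0 => y0 | cu 0 1 => y1 | cu 0 2 => y2 | cu 0 3 => y3 | cu 0 4 => y4
    | cu 2 0 => - bending (f x) (f1 x) (f2 x) y2 y3 y4 / m x
    | _ => 0
    end : R).
  specialize (H p Hx); rewrite eb_jet_explicit in H by exact Hx.
  rewrite (prolong_eb p Hx), (pd_eb_x p Hx), (prol_x2 p Hx), (prol_x3 p Hx), (prol_x4 p Hx),
    prol_t2 in H.
  unfold lin in H; simpl in H; unfold z in H; rewrite <- H.
  - unfold determining, bending; field; lra.
  - unfold bending; field; lra.
Qed.
End jets.

(** * The algebraic identity *)

(* [Leibnizk], [Faak] and [logk] are the k-th derivatives of a product, of a composite
   [Y(g)] (with [Y1], [Y2], ... evaluated at [g]), and of a solution of [h' = a h]. *)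
Definition Leibniz1 (a0 a1 b0 b1 : R) : R := a1 * b0 + a0 * b1.
Definition Leibniz2 (a0 a1 a2 b0 b1 b2 : R) : R := a2 * b0 + 2 * (a1 * b1) + a0 * b2.
Definition Leibniz3 (a0 a1 a2 a3 b0 b1 b2 b3 : R) : R :=
  a3 * b0 + 3 * (a2 * b1) + 3 * (a1 * b2) + a0 * b3.
Definition Leibniz4 (a0 a1 a2 a3 a4 b0 b1 b2 b3 b4 : R) : R :=
  a4 * b0 + 4 * (a3 * b1) + 6 * (a2 * b2) + 4 * (a1 * b3) + a0 * b4.

Lemma chain4_mult (J : R -> Prop) (a0 a1 a2 a3 a4 b0 b1 b2 b3 b4 : R -> R) :
  chain4 J a0 a1 a2 a3 a4 -> chain4 J b0 b1 b2 b3 b4 ->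
  chain4 J (fun x => a0 x * b0 x)
    (fun x => Leibniz1 (a0 x) (a1 x) (b0 x) (b1 x))
    (fun x => Leibniz2 (a0 x) (a1 x) (a2 x) (b0 x) (b1 x) (b2 x))
    (fun x => Leibniz3 (a0 x) (a1 x) (a2 x) (a3 x) (b0 x) (b1 x) (b2 x) (b3 x))
    (fun x => Leibniz4 (a0 x) (a1 x) (a2 x) (a3 x) (a4 x) (b0 x) (b1 x) (b2 x) (b3 x) (b4 x)).
Proof.
  intros Ha Hb x Hx; unfold Leibniz1, Leibniz2, Leibniz3, Leibniz4.
  split; [|split; [|split]]; chain_derive.
Qed.

Definition Faa2 (g1 g2 Y1 Y2 : R) : R := Y2 * g1 ^ 2 + Y1 * g2.
Definition Faa3 (g1 g2 g3 Y1 Y2 Y3 : R) : R :=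
  Y3 * g1 ^ 3 + 3 * Y2 * g1 * g2 + Y1 * g3.
Definition Faa4 (g1 g2 g3 g4 Y1 Y2 Y3 Y4 : R) : R :=
  Y4 * g1 ^ 4 + 6 * Y3 * g1 ^ 2 * g2 + Y2 * (3 * g2 ^ 2 + 4 * g1 * g3) + Y1 * g4.

Lemma chain4_comp (J K : R -> Prop) (g g1 g2 g3 g4 Y Y1 Y2 Y3 Y4 : R -> R) :
  (forall x, J x -> K (g x)) ->
  chain4 J g g1 g2 g3 g4 -> chain4 K Y Y1 Y2 Y3 Y4 ->
  chain4 J (fun x => Y (g x)) (fun x => Y1 (g x) * g1 x)
    (fun x => Faa2 (g1 x) (g2 x) (Y1 (g x)) (Y2 (g x)))
    (fun x => Faa3 (g1 x) (g2 x) (g3 x) (Y1 (g x)) (Y2 (g x)) (Y3 (g x)))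
    (fun x => Faa4 (g1 x) (g2 x) (g3 x) (g4 x) (Y1 (g x)) (Y2 (g x)) (Y3 (g x)) (Y4 (g x))).
Proof.
  intros HK Hg HY x Hx; unfold Faa2, Faa3, Faa4.
  destruct (HY (g x) (HK x Hx)) as [D0 [D1 [D2 D3]]]; clear HY.
  assert (E0 := is_derive_unique (fun y : R => Y y) _ _ D0).
  assert (E1 := is_derive_unique (fun y : R => Y1 y) _ _ D1).
  assert (E2 := is_derive_unique (fun y : R => Y2 y) _ _ D2).
  assert (E3 := is_derive_unique (fun y : R => Y3 y) _ _ D3).
  split; [|split; [|split]]; chain_derive; rewrite ?E0, ?E1, ?E2, ?E3; ring.
Qed.

Definition log2 (a a1 h : R) : R := (a1 + a ^ 2) * h.
Definition log3 (a a1 a2 h : R) : R := (a2 + 3 * a * a1 + a ^ 3) * h.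
Definition log4 (a a1 a2 a3 h : R) : R :=
  (a3 + 4 * a * a2 + 3 * a1 ^ 2 + 6 * a ^ 2 * a1 + a ^ 4) * h.

Lemma chain4_log (J : R -> Prop) (h a a1 a2 a3 a4 : R -> R) :
  chain4 J a a1 a2 a3 a4 -> (forall x, J x -> is_derive h x (a x * h x)) ->
  chain4 J h (fun x => a x * h x) (fun x => log2 (a x) (a1 x) (h x))
    (fun x => log3 (a x) (a1 x) (a2 x) (h x))
    (fun x => log4 (a x) (a1 x) (a2 x) (a3 x) (h x)).
Proof.
  intros Ha Hh x Hx; assert (Hd := Hh x Hx); clear Hh; unfold log2, log3, log4.
  split; [exact Hd|]; split; [|split]; chain_derive.
Qed.

(* [q], [s] and [-s] are the logarithmic derivatives of [g'], of [sqrt (f g'^3)] and of [c].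
   The hypotheses are the determining equations of [X4] and of [X3], whose coefficients
   are [g] times those of [X4]; [yj] is the j-th derivative of [c Y(g)]. *)
Lemma bending_identity (f g g1 c q q1 q2 q3 s s1 s2 s3 s4 : R) :
  g1 <> 0 ->
  let l := 2 * s - 3 * q in let l1 := 2 * s1 - 3 * q1 in let l2 := 2 * s2 - 3 * q2 in
  let f1 := l * f in let f2 := log2 l l1 f in let f3 := log3 l l1 l2 f in
  let g2 := q * g1 in let g3 := log2 q q1 g1 in let g4 := log3 q q1 q2 g1 in
  let xi := 2 / g1 in let xi1 := - q * xi in let xi2 := log2 (- q) (- q1) xi in
  let xi3 := log3 (- q) (- q1) (- q2) xi in
  let xi4 := log4 (- q) (- q1) (- q2) (- q3) xi in
  let ph := - s * xi in let ph1 := Leibniz1 (- s) (- s1) xi xi1 in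
  let ph2 := Leibniz2 (- s) (- s1) (- s2) xi xi1 xi2 in
  let ph3 := Leibniz3 (- s) (- s1) (- s2) (- s3) xi xi1 xi2 xi3 in
  let ph4 := Leibniz4 (- s) (- s1) (- s2) (- s3) (- s4) xi xi1 xi2 xi3 xi4 in
  let c1 := - s * c in let c2 := log2 (- s) (- s1) c in
  let c3 := log3 (- s) (- s1) (- s2) c in let c4 := log4 (- s) (- s1) (- s2) (- s3) c in
  let y1 Y0 Y1 := Leibniz1 c c1 Y0 (Y1 * g1) in
  let y2 Y0 Y1 Y2 := Leibniz2 c c1 c2 Y0 (Y1 * g1) (Faa2 g1 g2 Y1 Y2) in
  let y3 Y0 Y1 Y2 Y3 :=
    Leibniz3 c c1 c2 c3 Y0 (Y1 * g1) (Faa2 g1 g2 Y1 Y2) (Faa3 g1 g2 g3 Y1 Y2 Y3) in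
  let y4 Y0 Y1 Y2 Y3 Y4 :=
    Leibniz4 c c1 c2 c3 c4 Y0 (Y1 * g1) (Faa2 g1 g2 Y1 Y2) (Faa3 g1 g2 g3 Y1 Y2 Y3)
      (Faa4 g1 g2 g3 g4 Y1 Y2 Y3 Y4) in
  (forall y0 y1 y2 y3 y4,
    determining 0 (q + 2 * s) f f1 f2 f3 xi xi1 xi2 xi3 xi4 ph ph1 ph2 ph3 ph4
      y0 y1 y2 y3 y4 = 0) ->
  (forall y0 y1 y2 y3 y4,
    determining 4 (q + 2 * s) f f1 f2 f3
      (g * xi) (Leibniz1 g g1 xi xi1) (Leibniz2 g g1 g2 xi xi1 xi2)
      (Leibniz3 g g1 g2 g3 xi xi1 xi2 xi3) (Leibniz4 g g1 g2 g3 g4 xi xi1 xi2 xi3 xi4)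
      (g * ph) (Leibniz1 g g1 ph ph1) (Leibniz2 g g1 g2 ph ph1 ph2)
      (Leibniz3 g g1 g2 g3 ph ph1 ph2 ph3) (Leibniz4 g g1 g2 g3 g4 ph ph1 ph2 ph3 ph4)
      y0 y1 y2 y3 y4 = 0) ->
  forall Y0 Y1 Y2 Y3 Y4,
    bending f f1 f2 (y2 Y0 Y1 Y2) (y3 Y0 Y1 Y2 Y3) (y4 Y0 Y1 Y2 Y3 Y4)
    = c * f * g1 ^ 4 * Y4.
Proof.
  intros Hg l l1 l2 f1 f2 f3 g2 g3 g4 xi xi1 xi2 xi3 xi4 ph ph1 ph2 ph3 ph4 c1 c2 c3 c4
    y1 y2 y3 y4 E4 E3 Y0 Y1 Y2 Y3 Y4.
  (* With [L] the operator [bending f f1 f2], the difference below is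
     [2 c f g'^4 (2 p2 Y2 + 3 p1 Y1 + 4 p0 Y0)], so the jet with [Y0], [Y1], [Y2] divided
     by 8, 6, 4 gives exactly the lower-order part of [L(c Y(g))]. *)
  specialize (E4 (c * (Y0 / 8)) (y1 (Y0 / 8) (Y1 / 6)) (y2 (Y0 / 8) (Y1 / 6) (Y2 / 4))
    (y3 (Y0 / 8) (Y1 / 6) (Y2 / 4) 0) (y4 (Y0 / 8) (Y1 / 6) (Y2 / 4) 0 0)).
  specialize (E3 (c * (Y0 / 8)) (y1 (Y0 / 8) (Y1 / 6)) (y2 (Y0 / 8) (Y1 / 6) (Y2 / 4))
    (y3 (Y0 / 8) (Y1 / 6) (Y2 / 4) 0) (y4 (Y0 / 8) (Y1 / 6) (Y2 / 4) 0 0)).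
  match type of E4 with ?L4 = 0 => match type of E3 with ?L3 = 0 =>
    (* Inserting the left-hand sides of the two conditions turns the goal into an identity with all
       letters independent, valid wherever [g1] is nonzero. *)
    transitivity (c * f * g1 ^ 4 * Y4 + (L3 - g * L4)); [clear E3 E4|rewrite E3, E4; ring]
  end end.
  unfold determining, bending, y4, y3, y2, y1, Leibniz4, Leibniz3, Leibniz2,
    Leibniz1, Faa4, Faa3, Faa2,
    c4, c3, c2, c1, ph4, ph3, ph2, ph1, ph, xi4, xi3, xi2, xi1, xi, g4, g3, g2, f3, f2, f1,
    Leibniz4, Leibniz3, Leibniz2, Leibniz1, log4, log3, log2, l2, l1, l.
  field; exact Hg.
Qed.

(** * Reduction to the uniform equation *)

Lemma chain4_smooth (J : R -> Prop) (h : R -> R) : smooth J h ->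
  chain4 J h (Derive h) (Derive (Derive h)) (Derive (Derive (Derive h)))
    (Derive (Derive (Derive (Derive h)))).
Proof.
  intros H x Hx.
  split; [|split; [|split]]; apply (smooth_is_derive J); auto using smooth_Derive.
Qed.

Lemma chain4_opp (J : R -> Prop) (a a1 a2 a3 a4 : R -> R) :
  chain4 J a a1 a2 a3 a4 ->
  chain4 J (fun x => - a x) (fun x => - a1 x) (fun x => - a2 x) (fun x => - a3 x)
    (fun x => - a4 x).
Proof. intros H x Hx; split; [|split; [|split]]; chain_derive. Qed.

Lemma chain4_subset (J N : R -> Prop) (a a1 a2 a3 a4 : R -> R) :
  (forall x, N x -> J x) -> chain4 J a a1 a2 a3 a4 -> chain4 N a a1 a2 a3 a4.
Proof. intros HN H x Hx; exact (H x (HN x Hx)). Qed.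

Lemma Derive_n_2 (N : R -> Prop) (h h0 h1 h2 : R -> R) :
  open N -> (forall x, N x -> h x = h0 x) ->
  (forall x, N x -> is_derive h0 x (h1 x)) ->
  (forall x, N x -> is_derive h1 x (h2 x)) ->
  forall x, N x -> Derive_n h 2 x = h2 x.
Proof.
  intros HN E H0 H1 x Hx; rewrite (Derive_n_ext_loc h h0);
    [|apply (filter_imp N); [exact E|exact (HN x Hx)]].
  simpl; rewrite (Derive_ext_loc _ h1);
    [|apply (filter_imp N); [intros y Hy; apply is_derive_unique, H0, Hy|exact (HN x Hx)]].
  apply is_derive_unique, H1, Hx.
Qed.

Lemma Derive_n_bending (N : R -> Prop) (f f1 f2 f3 f4 h y0 y1 y2 y3 y4 : R -> R) :
  open N -> chain4 N f f1 f2 f3 f4 -> chain4 N y0 y1 y2 y3 y4 ->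
  (forall x, N x -> h x = y0 x) ->
  forall x, N x -> Derive_n (fun y => f y * Derive_n h 2 y) 2 x
                   = bending (f x) (f1 x) (f2 x) (y2 x) (y3 x) (y4 x).
Proof.
  intros HN Hf Hy Eh; apply (Derive_n_2 N _ (fun x => f x * y2 x)
    (fun x => f1 x * y2 x + f x * y3 x)
    (fun x => bending (f x) (f1 x) (f2 x) (y2 x) (y3 x) (y4 x))); [exact HN|..].
  - intros x Hx; f_equal; apply (Derive_n_2 N h y0 y1 y2);
      [exact HN|exact Eh|intros z Hz; apply Hy, Hz..|exact Hx].
  - intros x Hx; chain_derive.
  - intros x Hx; unfold bending; chain_derive.
Qed.

Lemma C2_zero (k : nat) (D : R * R -> Prop) : C2 k D (fun _ => 0).
Proof.
  induction k as [|k IH]; (split; [intros p _; apply continuous_const|]); [exact I|].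
  assert (E : (fun '(_, _) => 0) = (fun _ : R * R => 0))
    by (apply functional_extensionality; intros [? ?]; reflexivity).
  split; [intros; apply ex_derive_const|split; [intros; apply ex_derive_const|]].
  assert (Et : (fun '(t, x) => Derive (fun _ : R => 0) t) = (fun _ : R * R => 0))
    by (apply functional_extensionality; intros [t x]; apply Derive_const).
  assert (Ex : (fun '(t, x) => Derive (fun _ : R => 0) x) = (fun _ : R * R => 0))
    by (apply functional_extensionality; intros [t x]; apply Derive_const).
  cbv beta; rewrite Et, Ex; auto.
Qed.

(** Allows [X3] and [X4] themselves to be read off the class, with zero solution part. *)
Lemma eb_solution_zero (f m : R -> R) (Om : R * R -> Prop) :
  eb_solution f m Om (fun _ => 0).
Proof.
  split; [apply C2_zero|]; intros t x _.
  rewrite Derive_n_const, (Derive_n_ext _ (fun _ => 0)), Derive_n_const; [ring|].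
  intros y; rewrite Derive_n_const; ring.
Qed.

(** The logarithmic derivatives [q] of [g'] and [s] of [sqrt (f g'^3)], written without the root. In
    these terms [f'/f = 2 s - 3 q] and [m'/m = q + 2 s]. *)
Definition g_rate (g : R -> R) (x : R) : R := Derive (Derive g) x * / Derive g x.
Definition weight_rate (f g : R -> R) (x : R) : R :=
  / 2 * (Derive f x * / f x + 3 * g_rate g x).

(** * The fields [X3] and [X4] in logarithmic derivatives, and the transformed bending term *)

Section transform.
Variables (J : R -> Prop) (f m g : R -> R).
Hypothesis HJ : open J.
Hypothesis Hc : eb_coefficients J f m.
Hypothesis Hg : eb_gauge J f m g.

Lemma f_neq0 (x : R) : J x -> f x <> 0.
Proof. intros Hx; apply Rgt_not_eq, Hc, Hx. Qed.

Lemma g'_neq0 (x : R) : J x -> Derive g x <> 0.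
Proof. intros Hx; apply Rgt_not_eq, Hg, Hx. Qed.

Lemma smooth_g_rate : smooth J (g_rate g).
Proof.
  assert (H := g'_neq0); destruct Hg as [gs _]; unfold g_rate; smooth_auto HJ.
Qed.

Lemma smooth_weight_rate : smooth J (weight_rate f g).
Proof.
  assert (H := f_neq0); assert (Hq := smooth_g_rate); destruct Hc as [fs _].
  unfold weight_rate; smooth_auto HJ.
Qed.

Lemma is_derive_f (x : R) : J x ->
  is_derive f x ((2 * weight_rate f g x - 3 * g_rate g x) * f x).
Proof.
  intros Hx; replace ((2 * weight_rate f g x - 3 * g_rate g x) * f x) with (Derive f x).
  - apply (smooth_is_derive J); [apply Hc|exact Hx].
  - unfold weight_rate; field; exact (f_neq0 x Hx).
Qed.

Lemma is_derive_g' (x : R) : J x ->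
  is_derive (Derive g) x (g_rate g x * Derive g x).
Proof.
  intros Hx; replace (g_rate g x * Derive g x) with (Derive (Derive g) x).
  - apply (smooth_is_derive J); [apply smooth_Derive, Hg|exact Hx].
  - unfold g_rate; field; exact (g'_neq0 x Hx).
Qed.

Lemma is_derive_m (x : R) : J x ->
  is_derive m x ((g_rate g x + 2 * weight_rate f g x) * m x).
Proof.
  intros Hx; assert (E := proj2 (proj2 Hg x Hx)).
  apply (is_derive_ext_loc (fun x => Derive g x ^ 4 * f x)).
  - apply (filter_imp J); [intros y Hy; symmetry; apply Hg, Hy|exact (HJ x Hx)].
  - assert (Df := is_derive_f x Hx); assert (Dg := is_derive_g' x Hx).
    auto_derive; [repeat split; eexists; eassumption|].
    rewrite (is_derive_unique (fun y : R => f y) x _ Df),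
      (is_derive_unique (fun y : R => Derive g y) x _ Dg), E; ring.
Qed.

(** The coefficients of [X4]. The relation [phi4 = - s * xi4] says that [u sqrt (f g'^3)] is
    invariant under [X4], which is why the field becomes [2 d/dX]. *)
Definition xi4 (x : R) : R := 2 * / Derive g x.
Definition phi4 (x : R) : R := - weight_rate f g x * xi4 x.

Lemma is_derive_xi4 (x : R) : J x -> is_derive xi4 x (- g_rate g x * xi4 x).
Proof.
  intros Hx; unfold xi4; assert (H0 := g'_neq0 x Hx); assert (Dg := is_derive_g' x Hx).
  auto_derive; [repeat split; [eexists; exact Dg|exact H0]|].
  rewrite (is_derive_unique (fun y : R => Derive g y) x _ Dg); field; exact H0.
Qed.

Lemma smooth_xi4 : smooth J xi4.
Proof. assert (H := g'_neq0); destruct Hg as [gs _]; unfold xi4; smooth_auto HJ. Qed.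

Lemma smooth_phi4 : smooth J phi4.
Proof.
  apply (smooth_ext J (fun x => -1 * (weight_rate f g x * xi4 x)) phi4 HJ);
    [intros x _; unfold phi4; ring|].
  assert (Hs := smooth_weight_rate); assert (Hx := smooth_xi4); smooth_auto HJ.
Qed.

Lemma smooth_point_field (al : R) (xi ph : R -> R) : smooth J xi -> smooth J ph ->
  smooth_vfield J (VField (fun '(t, x, u) => al * t) (fun '(t, x, u) => xi x)
                          (fun '(t, x, u) => ph x * u)).
Proof.
  intros Hx Hp; assert (HT := @open_true R_UniformSpace); split; [|split].
  - apply (smooth3_separable J _ (fun t => al * t) (fun _ => 1) (fun _ => 1));
      [intros t x u H; exact H|smooth_auto HT|smooth_auto HJ|smooth_auto HT|].
    intros t x u; simpl; ring.
  - apply (smooth3_separable J _ (fun _ => 1) xi (fun _ => 1));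
      [intros t x u H; exact H|smooth_auto HT|exact Hx|smooth_auto HT|].
    intros t x u; simpl; ring.
  - apply (smooth3_separable J _ (fun _ => 1) ph (fun u => u));
      [intros t x u H; exact H|smooth_auto HT|exact Hp|smooth_auto HT|].
    intros t x u; simpl; ring.
Qed.

(** Both derivatives are positive fourth roots of [m / f]. *)
Lemma gauge_Derive (g0 : R -> R) (x : R) :
  eb_gauge J f m g0 -> J x -> Derive g0 x = Derive g x.
Proof.
  intros H0 Hx; destruct (proj2 H0 x Hx) as [P0 E0], (proj2 Hg x Hx) as [P E].
  rewrite E in E0; apply Rmult_eq_reg_r in E0; [|exact (f_neq0 x Hx)].
  (* The difference of the fourth powers, factored; positivity makes the second factor nonzero. *)
  assert (Z : (Derive g x - Derive g0 x)
    * ((Derive g x + Derive g0 x) * (Derive g x ^ 2 + Derive g0 x ^ 2)) = 0) by lra.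
  apply Rmult_integral in Z; destruct Z as [Z|Z]; [lra|exfalso].
  assert (0 < (Derive g x + Derive g0 x) * (Derive g x ^ 2 + Derive g0 x ^ 2));
    [|lra].
  apply Rmult_lt_0_compat; [lra|]; apply Rplus_lt_0_compat; apply pow_lt; assumption.
Qed.

Lemma gauge_Derive_2 (g0 : R -> R) (x : R) :
  eb_gauge J f m g0 -> J x -> Derive_n g0 2 x = Derive (Derive g) x.
Proof.
  intros H0 Hx; apply Derive_ext_loc; apply (filter_imp J); [|exact (HJ x Hx)].
  intros y Hy; apply gauge_Derive; assumption.
Qed.

Hypothesis Hclass : class_A33_A1 J f m.

(** The gauge [g0] of the class is undifferentiated only as the factor that turns the coefficients
    of [X4] into those of [X3]; elsewhere its derivatives are replaced by those of [g]. That
    [g0 - g] is constant need not be established. *)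
Lemma class_fields : exists g0 : R -> R,
  smooth J g0 /\ (forall x, J x -> Derive g0 x = Derive g x) /\
  eb_symmetry J f m (VField (fun '(t, x, u) => 0 * t) (fun '(t, x, u) => xi4 x)
                            (fun '(t, x, u) => phi4 x * u)) /\
  eb_symmetry J f m (VField (fun '(t, x, u) => 4 * t) (fun '(t, x, u) => g0 x * xi4 x)
                            (fun '(t, x, u) => g0 x * phi4 x * u)).
Proof.
  destruct Hclass as [_ [g0 [H0 Hsym]]]; exists g0.
  assert (s0 := proj1 H0); assert (sx := smooth_xi4); assert (sp := smooth_phi4).
  split; [exact s0|split; [intros x; apply gauge_Derive, H0|split]].
  - apply Hsym; [apply smooth_point_field; assumption|].
    exists 0, 0, 0, 1, (fun _ => 0); split; [apply eb_solution_zero|].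
    intros [[t x] u] Hx; simpl in Hx; simpl.
    rewrite (gauge_Derive g0 x H0 Hx); change (Derive (fun y => Derive (fun z => g0 z) y) x)
      with (Derive_n g0 2 x); rewrite (gauge_Derive_2 g0 x H0 Hx).
    unfold phi4, xi4, weight_rate, g_rate; repeat split;
      field; auto using f_neq0, g'_neq0.
  - apply Hsym; [apply smooth_point_field; smooth_auto HJ|].
    exists 0, 0, 1, 0, (fun _ => 0); split; [apply eb_solution_zero|].
    intros [[t x] u] Hx; simpl in Hx; simpl.
    rewrite (gauge_Derive g0 x H0 Hx); change (Derive (fun y => Derive (fun z => g0 z) y) x)
      with (Derive_n g0 2 x); rewrite (gauge_Derive_2 g0 x H0 Hx).
    unfold phi4, xi4, weight_rate, g_rate; repeat split;
      field; auto using f_neq0, g'_neq0.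
Qed.

(** The whole effect of the class on a time slice: the spatial operator applied to [c Y(g + k2)]
    keeps only the fourth derivative of [Y]. The sets [N] and [K] are meant to be slices of the
    domains of [u] and [U], so that local solutions are covered. *)
Lemma bending_transform (c : R -> R) (k2 : R) (N K : R -> Prop) (h Y Y1 Y2 Y3 Y4 : R -> R) :
  (forall x, J x -> is_derive c x (- weight_rate f g x * c x)) ->
  open N -> (forall x, N x -> J x) -> (forall x, N x -> K (g x + k2)) ->
  chain4 K Y Y1 Y2 Y3 Y4 -> (forall x, N x -> h x = c x * Y (g x + k2)) ->
  forall x, N x ->
    Derive_n (fun y => f y * Derive_n h 2 y) 2 x
    = c x * f x * Derive g x ^ 4 * Y4 (g x + k2).
Proof.
  intros Dc HN HNJ HNK HY Eh.
  destruct class_fields as [g0 [s0 [E0 [S4 S3]]]].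
  assert (Cq := chain4_smooth J _ smooth_g_rate).
  assert (Cs := chain4_smooth J _ smooth_weight_rate).
  assert (Cq' := chain4_opp J _ _ _ _ _ Cq); assert (Cs' := chain4_opp J _ _ _ _ _ Cs).
  assert (Cl : chain4 J (fun x => 2 * weight_rate f g x - 3 * g_rate g x)
    (fun x => 2 * Derive (weight_rate f g) x - 3 * Derive (g_rate g) x)
    (fun x => 2 * Derive (Derive (weight_rate f g)) x - 3 * Derive (Derive (g_rate g)) x)
    (fun x => 2 * Derive (Derive (Derive (weight_rate f g))) x
              - 3 * Derive (Derive (Derive (g_rate g))) x)
    (fun x => 2 * Derive (Derive (Derive (Derive (weight_rate f g)))) x
              - 3 * Derive (Derive (Derive (Derive (g_rate g)))) x)).
  { clear Cq' Cs'; intros x Hx.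
    destruct (Cq x Hx) as [A0 [A1 [A2 A3]]], (Cs x Hx) as [B0 [B1 [B2 B3]]].
    split; [|split; [|split]];
      (apply (is_derive_minus (fun y => 2 * _) (fun y => 3 * _));
        apply is_derive_scal; assumption). }
  assert (Cf := chain4_log J f _ _ _ _ _ Cl is_derive_f).
  assert (Cg' := chain4_log J (Derive g) _ _ _ _ _ Cq is_derive_g').
  assert (Cx := chain4_log J xi4 _ _ _ _ _ Cq' is_derive_xi4).
  assert (Cc := chain4_log J c _ _ _ _ _ Cs' Dc).
  assert (Cp := chain4_mult J _ _ _ _ _ _ _ _ _ _ Cs' Cx); fold phi4 in Cp.
  (* Stated for any antiderivative of [g'], because it serves both [g0], the factor in [X3], and
     [g + k2], the new variable. *)
  assert (Cg : forall g1, (forall x, J x -> is_derive g1 x (Derive g x)) ->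
    chain4 J g1 (Derive g) (fun x => g_rate g x * Derive g x)
      (fun x => log2 (g_rate g x) (Derive (g_rate g) x) (Derive g x))
      (fun x => log3 (g_rate g x) (Derive (g_rate g) x) (Derive (Derive (g_rate g)) x)
                  (Derive g x))).
  { intros g1 D1 x Hx; destruct (Cg' x Hx) as [A0 [A1 [A2 _]]]; auto. }
  assert (Cg0 : forall x, J x -> is_derive g0 x (Derive g x)).
  { intros x Hx; rewrite <- E0 by exact Hx; apply (smooth_is_derive J); assumption. }
  assert (Ck : forall x, J x -> is_derive (fun x => g x + k2) x (Derive g x)).
  { intros x Hx; assert (D := smooth_is_derive J g x (proj1 Hg) Hx).
    auto_derive; [eexists; exact D|apply Rmult_1_l]. }
  apply Cg in Cg0, Ck.
  assert (Cy := chain4_mult N _ _ _ _ _ _ _ _ _ _ (chain4_subset J N _ _ _ _ _ HNJ Cc)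
    (chain4_comp N K _ _ _ _ _ _ _ _ _ _ HNK (chain4_subset J N _ _ _ _ _ HNJ Ck) HY)).
  assert (Hm : forall x, J x ->
    0 < m x /\ is_derive m x ((fun x => g_rate g x + 2 * weight_rate f g x) x * m x)).
  { intros x Hx; split; [apply Hc, Hx|apply is_derive_m, Hx]. }
  intros x Hx; assert (Jx := HNJ x Hx).
  (* The letter [g] of the identity is [g0 x], while [Y0], ..., [Y4] are values at [g x + k2]; the
     identity assumes no relation between them. *)
  etransitivity; [|apply (bending_identity (f x) (g0 x) (Derive g x) (c x)
    (g_rate g x) (Derive (g_rate g) x) (Derive (Derive (g_rate g)) x)
    (Derive (Derive (Derive (g_rate g))) x)
    (weight_rate f g x) (Derive (weight_rate f g) x) (Derive (Derive (weight_rate f g)) x)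
    (Derive (Derive (Derive (weight_rate f g))) x)
    (Derive (Derive (Derive (Derive (weight_rate f g)))) x)
    (g'_neq0 x Jx)) with (Y0 := Y (g x + k2)) (Y1 := Y1 (g x + k2)) (Y2 := Y2 (g x + k2))
    (Y3 := Y3 (g x + k2))].
  - exact (Derive_n_bending N f _ _ _ _ h _ _ _ _ _ HN (chain4_subset J N _ _ _ _ _ HNJ Cf)
      Cy Eh x Hx).
  - intros y0 y1 y2 y3 y4.
    exact (symmetry_determining J f _ _ _ _ m _ HJ Cf Hm 0 _ _ _ _ _ _ _ _ _ _
      Cx Cp x y0 y1 y2 y3 y4 Jx S4).
  - intros y0 y1 y2 y3 y4.
    exact (symmetry_determining J f _ _ _ _ m _ HJ Cf Hm 4 _ _ _ _ _ _ _ _ _ _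
      (chain4_mult J _ _ _ _ _ _ _ _ _ _ Cg0 Cx) (chain4_mult J _ _ _ _ _ _ _ _ _ _ Cg0 Cp)
      x y0 y1 y2 y3 y4 Jx S3).
Qed.
End transform.

(** * The weight [sqrt (f g'^3)] and the explicit change of variables *)

Definition weight (f g : R -> R) (x : R) : R := sqrt (f x * Derive g x ^ 3).

Lemma weight_arg_pos (J : R -> Prop) (f m g : R -> R) (x : R) :
  eb_coefficients J f m -> eb_gauge J f m g -> J x -> 0 < f x * Derive g x ^ 3.
Proof.
  intros Hc Hg Hx; apply Rmult_lt_0_compat; [apply Hc, Hx|apply pow_lt, Hg, Hx].
Qed.

Lemma weight_neq0 (J : R -> Prop) (f m g : R -> R) (k x : R) : k <> 0 ->
  eb_coefficients J f m -> eb_gauge J f m g -> J x -> k * weight f g x <> 0.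
Proof.
  intros Hk Hc Hg Hx; apply Rmult_integral_contrapositive_currified; [exact Hk|].
  apply Rgt_not_eq, sqrt_lt_R0, (weight_arg_pos J f m g x Hc Hg Hx).
Qed.

Lemma smooth_weight (J : R -> Prop) (f m g : R -> R) : open J ->
  eb_coefficients J f m -> eb_gauge J f m g -> smooth J (weight f g).
Proof.
  intros HJ Hc Hg; assert (H := fun x => weight_arg_pos J f m g x Hc Hg).
  destruct Hc as [fs _], Hg as [gs _].
  change (smooth J (fun x =>
    sqrt (f x * (Derive g x * (Derive g x * (Derive g x * 1)))))).
  smooth_auto HJ.
Qed.

(** A constant factor does not affect a logarithmic derivative, so for every [k <> 0] this function
    is an admissible [c] in [bending_transform]. This is where the freedom in [k3] comes from. *)
Lemma is_derive_inv_weight (J : R -> Prop) (f m g : R -> R) (k x : R) : k <> 0 ->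
  eb_coefficients J f m -> eb_gauge J f m g -> J x ->
  is_derive (fun x => / (k * weight f g x)) x (- weight_rate f g x * / (k * weight f g x)).
Proof.
  intros Hk Hc Hg Hx; assert (H0 := weight_neq0 J f m g k x Hk Hc Hg Hx).
  assert (Hp := weight_arg_pos J f m g x Hc Hg Hx).
  assert (Df := is_derive_f J f m g Hc x Hx).
  assert (Dg := is_derive_g' J f m g Hg x Hx).
  assert (Dw : is_derive (weight f g) x (weight_rate f g x * weight f g x)).
  { replace (weight_rate f g x * weight f g x)
      with (2 * weight_rate f g x * (f x * Derive g x ^ 3) / (2 * sqrt (f x * Derive g x ^ 3))).
    - apply (is_derive_sqrt (fun x => f x * Derive g x ^ 3)); [|exact Hp].
      auto_derive; [repeat split; eexists; eassumption|].
      rewrite (is_derive_unique (fun y : R => f y) x _ Df),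
        (is_derive_unique (fun y : R => Derive g y) x _ Dg); ring.
    - unfold weight; rewrite <- (sqrt_sqrt (f x * Derive g x ^ 3)) at 1 by lra.
      field; apply Rgt_not_eq, sqrt_lt_R0, Hp. }
  auto_derive; [repeat split; [eexists; exact Dw|exact H0]|].
  rewrite (is_derive_unique (fun y : R => weight f g y) x _ Dw).
  field; split; [|exact Hk]; intros E; apply H0; rewrite E; ring.
Qed.

(** The destructuring follows the x-branch of [C2] through its four levels. *)
Lemma C2_chain_x (D : R * R -> Prop) (U : R * R -> R) (T : R) : C2 4 D U ->
  chain4 (fun X => D (T, X)) (fun X => U (T, X)) (Derive_n (fun X => U (T, X)) 1)
    (Derive_n (fun X => U (T, X)) 2) (Derive_n (fun X => U (T, X)) 3)
    (Derive_n (fun X => U (T, X)) 4).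
Proof.
  intros [_ [_ [H0 [_ [_ [_ [H1 [_ [_ [_ [H2 [_ [_ [_ [H3 _]]]]]]]]]]]]]]] X HX.
  split; [|split; [|split]]; apply Derive_correct;
    [exact (H0 T X HX)|exact (H1 T X HX)|exact (H2 T X HX)|exact (H3 T X HX)].
Qed.

Section explicit.
Variables (a b : Rbar) (f m g : R -> R) (k1 k2 k3 : R).
Hypothesis Hclass : class_A33_A1 (itv a b) f m.
Hypothesis Hg : eb_gauge (itv a b) f m g.
Hypothesis Hk3 : k3 <> 0.

Let J := itv a b.
Let HJ : open J := open_itv a b.
Let Hc : eb_coefficients J f m := proj1 Hclass.
Let Phi := explicit_change f g k1 k2 k3.
Let w (x : R) : R := k3 * weight f g x.
Let g'pos : forall x, itv a b x -> 0 < Derive g x := fun x Hx => proj1 (proj2 Hg x Hx).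
Let Jim (X : R) : Prop := image1 a b g (X - k2).
Let h (X : R) : R := inverse1 a b g (X - k2).

Lemma w_neq0 (x : R) : J x -> w x <> 0.
Proof. exact (weight_neq0 J f m g k3 x Hk3 Hc Hg). Qed.

Lemma smooth_w : smooth J w.
Proof.
  assert (H := smooth_weight J f m g HJ Hc Hg); unfold w; smooth_auto HJ.
Qed.

Lemma Jim_g (x : R) : J x -> Jim (g x + k2).
Proof. intros Hx; exists x; split; [exact Hx|ring]. Qed.

Lemma Jim_h (X : R) : Jim X -> J (h X) /\ g (h X) + k2 = X.
Proof.
  intros HX; destruct (inverse1_spec a b g _ HX) as [Hh E]; split; [exact Hh|].
  unfold h; rewrite E; ring.
Qed.

Lemma h_g (x : R) : J x -> h (g x + k2) = x.
Proof.
  intros Hx; unfold h; replace (g x + k2 - k2) with (g x) by ring.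
  apply inverse1_left; [apply Hg|exact g'pos|exact Hx].
Qed.

Lemma open_Jim : open Jim.
Proof.
  apply (open_comp (fun X : R => X - k2) (image1 a b g)).
  - intros X _; apply (continuous_minus (fun X : R => X) (fun _ => k2));
      [apply continuous_id|apply continuous_const].
  - apply open_image1; [apply Hg|exact g'pos].
Qed.

Lemma smooth_h : smooth Jim h.
Proof.
  apply smooth_expr_smooth; [exact open_Jim|].
  apply (se_comp Jim (image1 a b g) (inverse1 a b g) (fun X => X - k2)).
  - apply smooth_inverse1; [apply Hg|exact g'pos].
  - intros X HX; exact HX.
  - apply (se_plus Jim (fun X => X) (fun _ => - k2)); apply se_base;
      [apply smooth_id, open_Jim|apply smooth_const, open_Jim].
Qed.

Lemma smooth_comp_h (A : R -> R) : smooth J A -> smooth Jim (fun X => A (h X)).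
Proof.
  intros HA; apply smooth_expr_smooth; [exact open_Jim|].
  apply (se_comp Jim J A h); [exact HA|intros X HX; apply Jim_h, HX|].
  apply se_base, smooth_h.
Qed.

(** At fixed [t] and [x] the map is a nonzero multiple of [u], hence onto the real line; so the
    image is again a full cylinder, over the shifted image of [g]. *)
Lemma image_Phi (q : R * R * R) : cylinder Jim q <-> image3 (cylinder J) Phi q.
Proof.
  destruct q as [[T X] V]; split.
  - intros HX; destruct (Jim_h X HX) as [Hh E].
    exists (T - k1, h X, V * / w (h X)); split; [exact Hh|].
    unfold Phi, explicit_change; rewrite E; f_equal; [f_equal; ring|].
    change (sqrt (f (h X) * Derive g (h X) ^ 3)) with (weight f g (h X)).
    assert (H0 := w_neq0 _ Hh); unfold w in H0 |- *.
    field; split; [|exact Hk3]; intros E0; apply H0; rewrite E0; ring.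
  - intros [[[t x] u] [Hx E]]; injection E as _ <- _; apply Jim_g, Hx.
Qed.

Lemma invertible_explicit : invertible_change (cylinder J) Phi.
Proof.
  assert (HT := @open_true R_UniformSpace).
  assert (gs := proj1 Hg : smooth J g); assert (ws := smooth_w).
  assert (his := smooth_h).
  assert (HJm := open_Jim).
  assert (wis : smooth Jim (fun X => / w (h X))).
  { apply (smooth_comp_h (fun x => / w x)).
    assert (H0 := w_neq0); smooth_auto HJ. }
  split; [|split].
  - split; [|split].
    + apply (smooth3_separable J _ (fun t => t + k1) (fun _ => 1) (fun _ => 1));
        [intros t x u H; exact H|smooth_auto HT|smooth_auto HJ|smooth_auto HT|].
      intros t x u; simpl; ring.
    + apply (smooth3_separable J _ (fun _ => 1) (fun x => g x + k2) (fun _ => 1));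
        [intros t x u H; exact H|smooth_auto HT|smooth_auto HJ|smooth_auto HT|].
      intros t x u; simpl; ring.
    + apply (smooth3_separable J _ (fun _ => 1) w (fun u => u));
        [intros t x u H; exact H|smooth_auto HT|exact ws|smooth_auto HT|].
      intros t x u; simpl; unfold w, weight; simpl; ring.
  - apply (open_ext _ _ image_Phi).
    apply (open_ext (fun q : R * R * R => Jim (snd (fst q))));
      [intros [[T X] V]; reflexivity|].
    apply (open_comp (fun q : R * R * R => snd (fst q)) Jim); [|exact HJm].
    intros q _; apply (continuous_comp fst snd); [|apply continuous_snd].
    destruct q; apply continuous_fst.
  - exists (fun '(T, X, V) => (T - k1, h X, V * / w (h X))); split.
    + assert (HD : forall T X V, image3 (cylinder J) Phi (T, X, V) -> Jim X)
        by (intros T X V HX; apply image_Phi in HX; exact HX).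
      split; [|split].
      * apply (smooth3_separable Jim _ (fun T => T + - k1) (fun _ => 1) (fun _ => 1));
          [exact HD|smooth_auto HT|smooth_auto HJm|smooth_auto HT|].
        intros t x u; simpl; ring.
      * apply (smooth3_separable Jim _ (fun _ => 1) h (fun _ => 1));
          [exact HD|smooth_auto HT|exact his|smooth_auto HT|].
        intros t x u; simpl; ring.
      * apply (smooth3_separable Jim _ (fun _ => 1) (fun X => / w (h X)) (fun u => u));
          [exact HD|smooth_auto HT|exact wis|smooth_auto HT|].
        intros t x u; simpl; ring.
    + intros [[t x] u] Hx; unfold Phi, explicit_change.
      rewrite (h_g x Hx); f_equal; [f_equal; ring|].
      change (k3 * u * weight f g x * / w x = u).
      assert (H0 := w_neq0 x Hx); unfold w in H0 |- *.
      field; split; [|exact Hk3]; intros E0; apply H0; rewrite E0; ring.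
Qed.

(** The correspondence of graphs says that [u = U / w] along the change of variables and that [Om']
    is the image of [Om]. The two left-hand sides then differ by the nowhere zero factor [m / w],
    and regularity transfers in both directions. *)
Lemma explicit_maps_to_uniform : maps_to_uniform J f m Phi.
Proof.
  intros Om Om' u U HO HO' HOJ Htr.
  assert (HOJ' : forall t x, Om (t, x) -> J x) by (intros t x Hp; exact (HOJ _ Hp)).
  assert (F : forall t x, Om (t, x) ->
    Om' (t + k1, g x + k2) /\ u (t, x) = / w x * U (t + k1, g x + k2)).
  { intros t x Hp; destruct (proj1 (Htr (Phi (t, x, u (t, x))))) as [T [X [HX E]]].
    { exists t, x; auto. }
    injection E as <- <- E; split; [exact HX|]; rewrite <- E.
    change (sqrt _) with (weight f g x).
    assert (H0 := w_neq0 x (HOJ' t x Hp)); unfold w in H0 |- *.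
    field; split; [|exact Hk3]; intros E0; apply H0; rewrite E0; ring. }
  assert (B : forall T X, Om' (T, X) ->
    exists t x, Om (t, x) /\ T = t + k1 /\ X = g x + k2).
  { intros T X HX; destruct (proj2 (Htr (T, X, U (T, X)))) as [t [x [Hp E]]].
    { exists T, X; auto. }
    exists t, x; injection E as <- <- _; auto. }
  assert (ws := smooth_w).
  assert (wis : smooth J (fun x => / w x)) by (assert (H0 := w_neq0); smooth_auto HJ).
  assert (CU : C2 4 Om' U -> C2 4 Om u).
  { intros HU; apply (C2_ext 4 Om (fun '(t, x) => / w x * U (t + k1, g x + k2)));
      [exact HO|intros [t x] Hp; symmetry; apply F, Hp|].
    assert (gs := proj1 Hg : smooth J g).
    apply (C2_change 4 J Om Om' k1 (fun x => / w x) (fun x => g x + k2) U HJ HO HOJ');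
      [exact wis|smooth_auto HJ|intros t x Hp; apply F, Hp|exact HU]. }
  (* The inverse change has the same shape, with multiplier [w (h X)], shift [- k1] and base map
     [h], so [C2_change] applies again. *)
  assert (Cu : C2 4 Om u -> C2 4 Om' U).
  { intros Hu; apply (C2_ext 4 Om' (fun '(T, X) => w (h X) * u (T + - k1, h X)));
      [exact HO'| |].
    - intros [T X] HX; destruct (B T X HX) as [t [x [Hp [-> ->]]]].
      rewrite (h_g x (HOJ' t x Hp)); replace (t + k1 + - k1) with t by ring.
      rewrite (proj2 (F t x Hp)); field; apply w_neq0, (HOJ' t x Hp).
    - apply (C2_change 4 Jim Om' Om (- k1) (fun X => w (h X)) h u open_Jim HO');
        [|exact (smooth_comp_h w ws)|exact smooth_h| |exact Hu].
      + intros T X HX; destruct (B T X HX) as [t [x [Hp [-> ->]]]].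
        apply Jim_g, (HOJ' t x Hp).
      + intros T X HX; destruct (B T X HX) as [t [x [Hp [-> ->]]]].
        rewrite (h_g x (HOJ' t x Hp)); replace (t + k1 + - k1) with t by ring; exact Hp. }
  (* Regularity of [U] is a premise because [bending_transform] takes its chain of derivatives from
     [U]; when [u] is the given solution, it is supplied by [Cu]. *)
  assert (Key : C2 4 Om' U -> forall t x, Om (t, x) ->
    Derive_n (fun y => f y * Derive_n (fun z => u (t, z)) 2 y) 2 x
      + m x * Derive_n (fun s => u (s, x)) 2 t
    = / w x * m x * (Derive_n (fun Y => U (t + k1, Y)) 4 (g x + k2)
                     + Derive_n (fun s => U (s, g x + k2)) 2 (t + k1))).
  { intros HU t x Hp; assert (Jx := HOJ' t x Hp).
    rewrite (bending_transform J f m g HJ Hc Hg Hclass (fun x => / w x) k2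
      (fun x => Om (t, x)) (fun X => Om' (t + k1, X)) (fun z => u (t, z))
      _ _ _ _ _ (fun y Hy => is_derive_inv_weight J f m g k3 y Hk3 Hc Hg Hy)
      (fun y Hy => open_slice_x Om t y HO Hy) (fun y Hy => HOJ' t y Hy)
      (fun y Hy => proj1 (F t y Hy)) (C2_chain_x Om' U (t + k1) HU)
      (fun y Hy => proj2 (F t y Hy)) x Hp).
    rewrite (Derive_n_ext_loc (fun s => u (s, x)) (fun s => / w x * U (s + k1, g x + k2))).
    - rewrite Derive_n_scal_l,
        (Derive_n_comp_trans (fun s => U (s, g x + k2)) 2 t k1).
      rewrite (proj2 (proj2 Hg x Jx)); ring.
    - apply (filter_imp (fun s => Om (s, x))); [intros s Hs; apply F, Hs|].
      apply open_slice_t; assumption. }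
  split; intros [HC HE]; (split; [auto|]).
  - intros T X HX; destruct (B T X HX) as [t [x [Hp [-> ->]]]].
    assert (Jx := HOJ' t x Hp); specialize (HE t x Hp).
    rewrite (Key (Cu HC) t x Hp) in HE; apply Rmult_integral in HE.
    destruct HE as [HE|HE]; [exfalso|exact HE]; revert HE.
    apply Rmult_integral_contrapositive_currified.
    + apply Rinv_neq_0_compat, w_neq0, Jx.
    + apply Rgt_not_eq, Hc, Jx.
  - intros t x Hp; rewrite (Key HC t x Hp), HE; [ring|apply F, Hp].
Qed.
End explicit.

Theorem theorem2 (a b : Rbar) (f m : R -> R)
  (hab : Rbar_lt a b) (hclass : class_A33_A1 (itv a b) f m) :
  (exists Phi : R * R * R -> R * R * R,
     invertible_change (cylinder (itv a b)) Phi /\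
     maps_to_uniform (itv a b) f m Phi)
  /\
  (forall g : R -> R, eb_gauge (itv a b) f m g ->
   forall k1 k2 k3 : R, k3 <> 0 ->
     invertible_change (cylinder (itv a b)) (explicit_change f g k1 k2 k3) /\
     maps_to_uniform (itv a b) f m (explicit_change f g k1 k2 k3)).
Proof.
  assert (H : forall g : R -> R, eb_gauge (itv a b) f m g ->
    forall k1 k2 k3 : R, k3 <> 0 ->
      invertible_change (cylinder (itv a b)) (explicit_change f g k1 k2 k3) /\
      maps_to_uniform (itv a b) f m (explicit_change f g k1 k2 k3)).
  { intros g Hg k1 k2 k3 Hk; split;
      [apply (invertible_explicit a b f m g k1 k2 k3)
      |apply (explicit_maps_to_uniform a b f m g k1 k2 k3)]; assumption. }
  split; [|exact H].
  destruct hclass as [_ [g [Hg _]]].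
  exists (explicit_change f g 0 0 1); apply H; [exact Hg|exact R1_neq_R0].
Qed.
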